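(* Let $(i,j)\in\mathbb{Z}^2\setminus\mathcal H$. There exist Laurent polynomials $f(z)$ with coefficients in $\mathbb{Q}$ and $g(z)$ with coefficients in $\mathbb{Q}[\sqrt2]$, with $f(1)=1$ and $g(1)\ne0$, such that $$\sum_{k\ge0}p^{[k]}_{i,j}z^k=f(z)-g(z)\sqrt{(1-z)\left(1-z(\sqrt2-1)^2\right)}.$$ Consequently, as $k\to\infty$, $$p^{[k]}_{i,j}\sim g(1)\sqrt{\frac{\sqrt2-1}{2\pi}}\,k^{-3/2},\qquad \sum_{\ell\ge k}p^{[\ell]}_{i,j}\sim g(1)\sqrt{\frac{2(\sqrt2-1)}{\pi}}\,k^{-1/2}.$$ For $(i,j)=(1,0)$ one has $f(z)=g(z)=1/z$ (so $g(1)=1$).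
   Context: $\mathcal H=\{(k,0):k\in\mathbb{Z},k\le0\}$. Let $(W_n)_{n\ge0}$ be the simple random walk on $\mathbb{Z}^2$ (each step uniform in $\{(\pm1,0),(0,\pm1)\}$) started at $W_0=(i,j)\notin\mathcal H$, and $\tau=\min\{n\ge0:W_n\in\mathcal H\}$ (finite almost surely). $p^{[k]}_{i,j}=\Pr(W_\tau=(-k,0))$ for $k\ge0$. The square root is the branch equal to $1$ at $z=0$, and the series converges for $|z|\le1$. *)

(* Defs.v *)
From Stdlib Require Import Reals ZArith QArith List.
From Coquelicot Require Import Coquelicot.
Open Scope R_scope.

Definition inH (x y : Z) : bool := ((y =? 0) && (x <=? 0))%Z.

(* hitq n x y k = Pr_{(x,y)}(tau = n and W_tau = (-k,0)) for the simple
   random walk on Z^2: computed by the first-step decomposition, i.e. the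
   sum over all n-step nearest-neighbour paths from (x,y) that first enter H
   at step n at the point (-k,0), each weighted by 4^{-n}. *)
Fixpoint hitq (n : nat) (x y : Z) (k : nat) : R :=
  match n with
  | O => if inH x y && (x =? - Z.of_nat k)%Z && (y =? 0)%Z then 1 else 0
  | S n' => if inH x y then 0 else
      / 4 * (hitq n' (x + 1) y k + hitq n' (x - 1) y k
             + hitq n' x (y + 1) k + hitq n' x (y - 1) k)
  end.

Definition p_hit (i j : Z) (k : nat) : R := Series (fun n => hitq n i j k).

Definition Cpowz (z : C) (m : Z) : C :=
  match m with
  | Z0 => RtoC 1
  | Zpos q => Cpow z (Pos.to_nat q)
  | Zneg q => Cinv (Cpow z (Pos.to_nat q))
  end.

Fixpoint laurentQ (m : Z) (cs : list Q) (z : C) : C :=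
  match cs with
  | nil => RtoC 0
  | c :: cs' => Cplus (Cmult (RtoC (Q2R c)) (Cpowz z m)) (laurentQ (m + 1) cs' z)
  end.

Fixpoint laurentQs2 (m : Z) (cs : list (Q * Q)) (z : C) : C :=
  match cs with
  | nil => RtoC 0
  | c :: cs' =>
      Cplus (Cmult (RtoC (Q2R (fst c) + Q2R (snd c) * sqrt 2)) (Cpowz z m))
            (laurentQs2 (m + 1) cs' z)
  end.

(* Principal square root of a complex number (branch cut on the negative
   real axis); on the closed unit disk it is the branch of
   sqrt((1-z)(1-z(sqrt2-1)^2)) equal to 1 at z = 0. *)
Definition Csqrt (w : C) : C :=
  (sqrt ((Cmod w + fst w) / 2),
   if Rlt_dec (snd w) 0 then - sqrt ((Cmod w - fst w) / 2)
   else sqrt ((Cmod w - fst w) / 2)).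

Definition sq_factor (z : C) : C :=
  Csqrt (Cmult (Cminus (RtoC 1) z)
               (Cminus (RtoC 1) (Cmult z (RtoC ((sqrt 2 - 1) ^ 2))))).

(* Main.v *)
Require Import Defs.
From Stdlib Require Import Reals ZArith QArith Qreals List Lra Lia Psatz.
From Coquelicot Require Import Coquelicot.
Open Scope R_scope.

(** The generating function G of the hitting distribution from (x,y) is the bounded function,
    harmonic off H, with boundary values z^k at (-k,0); bounded harmonic functions off H that
    vanish on H are zero, since H is hit from anywhere with probability at least 1/2.

    Shifting the slit by one gives G(x,y) - z G(x+1,y) = p0(x,y) D(z), with p0 the
    probability of ending at the tip and D(z) = 1 - z G(1,0).  Hence everything follows from
    D(z)^2 = (1-z)(1-alpha z), alpha = (sqrt 2 - 1)^2.  For this, take the discrete harmonic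
    conjugate of p0 in the upper half-plane: its boundary value is the normal derivative of p0,
    which lives on H and, by time reversal, is proportional to the coefficients of D; its own
    normal derivative is a local difference operator applied to p0, since the square of the
    Dirichlet-to-Neumann operator is local.  Reflected in the y-axis it therefore solves the same
    boundary value problem as three translates of p0, so D is a quadratic polynomial times the
    generating function of p0 on the axis, which is 1/D.

    The asymptotics of the coefficients of D come from Wallis' formula, and the constants g(1),
    being limits of k^(3/2) p^[k], form a nonnegative harmonic function of the starting point. *)

(** * The maximum principle in the slit plane *)

(** The conjugate is built from transfer operators. With $X$ the unit shift in $x$ and $T$ the step
    upwards, harmonicity in the upper half-plane reads $T+T^{-1}=L$, $L=4-X-X^{-1}$. The conjugate
    is $(T-T^{-1})p_0$; on the axis $T^{-1}$ means $L-T$, the harmonic continuation from above, and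
    evenness of $p_0$ in $y$ turns this value into the Laplacian of $p_0$. Applied twice, the
    operator gives $L^2-4=(2-X-X^{-1})(6-X-X^{-1})$, whose factors vanish at $X=1$ and at
    $X=\alpha^{\pm1}=3\mp2\sqrt2$. This is the origin of $\alpha$: the polynomial $(1-z)(1-\alpha
    z)$ is half of that symbol, up to the constant $1/\alpha=(1+\sqrt2)^2$. For a general starting
    point the asymptotics are not extracted from $f-g\sqrt{\cdot}$ by singularity analysis. The pair
    $f,g$ and the limit of $k^{3/2}p^{[k]}$ are propagated side by side from the origin, along rows
    by the shift relation and between rows by harmonicity; each move changes $g(1)$ and the limit by
    the same linear rule. The irrational tip probabilities enter only multiplied by $1-D$, and their
    contribution to $f$ cancels, so $f$ stays rational. *)

Definition harmonic_at (F : Z -> Z -> R) (x y : Z) : Prop :=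
  4 * F x y = F (x + 1)%Z y + F (x - 1)%Z y + F x (y + 1)%Z + F x (y - 1)%Z.

(** By convexity a single positive increment would persist and force linear growth past [B], so no
    increment is positive. *)
Lemma convex_bounded_decr (M : nat -> R) (B : R) :
  (forall n, M n <= B) ->
  (forall n, 2 * M (S n) <= M n + M (S (S n))) ->
  forall n, M n <= M 0%nat.
Proof.
  intros HB Hc.
  assert (Hd : forall j, M (S j) <= M j).
  { intros j. destruct (Rle_or_lt (M (S j)) (M j)) as [H|H]; [exact H|exfalso].
    assert (Hk : forall k, M (S j) - M j <= M (S (j + k)) - M (j + k)%nat).
    { induction k as [|k IH].
      - rewrite Nat.add_0_r. lra.
      - rewrite Nat.add_succ_r. specialize (Hc (j + k)%nat). lra. }
    assert (Hs : forall k, M j + INR k * (M (S j) - M j) <= M (j + k)%nat).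
    { induction k as [|k IH].
      - rewrite Nat.add_0_r. simpl. lra.
      - rewrite Nat.add_succ_r, S_INR. specialize (Hk k). lra. }
    destruct (nfloor_ex (Rmax 0 ((B - M j) / (M (S j) - M j)))) as [n [_ Hn]].
    { apply Rmax_l. }
    specialize (Hs (S n)). specialize (HB (j + S n)%nat).
    rewrite S_INR in Hs.
    assert (H1 : (B - M j) / (M (S j) - M j) < INR n + 1).
    { eapply Rle_lt_trans; [apply Rmax_r|exact Hn]. }
    apply (Rmult_lt_compat_r (M (S j) - M j)) in H1; [|lra].
    unfold Rdiv in H1. rewrite Rmult_assoc, Rinv_l, Rmult_1_r in H1 by lra. lra. }
  induction n as [|n IH]; [lra|]. specialize (Hd n). lra.
Qed.

(* The supremum over a horizontal line is a bounded convex function of the height, hence decreasing. *)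
Lemma halfplane_max (F : Z -> Z -> R) (m B : R) :
  (forall x y, (0 <= y)%Z -> F x y <= B) ->
  (forall x, F x 0%Z <= m) ->
  (forall x y, (0 < y)%Z -> harmonic_at F x y) ->
  forall x y, (0 <= y)%Z -> F x y <= m.
Proof.
  intros HB H0 Hh.
  assert (Hlub : forall n : nat, {s : R | is_lub (fun r => exists x, r = F x (Z.of_nat n)) s}).
  { intros n. apply completeness.
    - exists B. intros r [x ->]. apply HB. lia.
    - exists (F 0%Z (Z.of_nat n)), 0%Z. reflexivity. }
  pose (M := fun n => proj1_sig (Hlub n)).
  assert (Hub : forall n x, F x (Z.of_nat n) <= M n).
  { intros n x. unfold M. destruct (Hlub n) as [s [Hs1 Hs2]]; simpl.
    apply Hs1. exists x; reflexivity. }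
  assert (Hle : forall n r, (forall x, F x (Z.of_nat n) <= r) -> M n <= r).
  { intros n r Hr. unfold M. destruct (Hlub n) as [s [Hs1 Hs2]]; simpl.
    apply Hs2. intros t [x ->]. apply Hr. }
  assert (HM : forall n, M n <= M 0%nat).
  { apply (convex_bounded_decr M B).
    - intros n. apply Hle. intros x. apply HB. lia.
    - intros n. cut (M (S n) <= (2 * M (S n) + M n + M (S (S n))) / 4); [lra|].
      apply Hle. intros x.
      assert (E := Hh x (Z.of_nat (S n)) ltac:(lia)). unfold harmonic_at in E.
      replace (Z.of_nat (S n) + 1)%Z with (Z.of_nat (S (S n))) in E by lia.
      replace (Z.of_nat (S n) - 1)%Z with (Z.of_nat n) in E by lia.
      assert (E1 := Hub (S n) (x + 1)%Z). assert (E2 := Hub (S n) (x - 1)%Z).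
      assert (E3 := Hub (S (S n)) x). assert (E4 := Hub n x). lra. }
  intros x y Hy. rewrite <- (Z2Nat.id y) by lia.
  eapply Rle_trans; [apply Hub|]. eapply Rle_trans; [apply HM|].
  apply Hle. intros x'. apply H0.
Qed.

Lemma inH_true_iff (x y : Z) : inH x y = true <-> y = 0%Z /\ (x <= 0)%Z.
Proof.
  unfold inH. rewrite Bool.andb_true_iff, Z.eqb_eq, Z.leb_le. tauto.
Qed.

Lemma inH_false_iff (x y : Z) : inH x y = false <-> y <> 0%Z \/ (0 < x)%Z.
Proof.
  rewrite <- Bool.not_true_iff_false, inH_true_iff. lia.
Qed.

(** One of the points $(\pm x,0)$ lies on the slit, where $F\le0$, so $F(x,y)+F(-x,y)$ is at most
    $M$ on the axis and hence in either half-plane. On the column $x=0$ this sum is $2F$, which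
    gains the factor one half. The bound then spreads from the column to the right half-plane, to
    the whole axis, and to the upper and lower half-planes. *)
Lemma slit_max_half (F : Z -> Z -> R) (M : R) :
  0 <= M ->
  (forall x y, F x y <= M) ->
  (forall x y, inH x y = true -> F x y <= 0) ->
  (forall x y, inH x y = false -> harmonic_at F x y) ->
  forall x y, F x y <= M / 2.
Proof.
  intros HM HF H0 Hh.
  assert (Hcol : forall y, (0 <= y)%Z -> F 0%Z y <= M / 2 /\ F 0%Z (- y)%Z <= M / 2).
  { intros y Hy. split.
    - assert (H := halfplane_max (fun x y => F x y + F (- x)%Z y) M (2 * M)).
      simpl in H. cut (F 0%Z y + F (- 0)%Z y <= M). { simpl. lra. }
      apply H; try assumption.
      + intros x' y' _. assert (H1 := HF x' y'). assert (H2 := HF (- x')%Z y'). lra.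
      + intros x'. destruct (Z_le_gt_dec x' 0).
        * assert (H1 := H0 x' 0%Z ltac:(apply inH_true_iff; lia)).
          assert (H2 := HF (- x')%Z 0%Z). lra.
        * assert (H1 := H0 (- x')%Z 0%Z ltac:(apply inH_true_iff; lia)).
          assert (H2 := HF x' 0%Z). lra.
      + intros x' y' Hy'.
        assert (E1 := Hh x' y' ltac:(apply inH_false_iff; lia)).
        assert (E2 := Hh (- x')%Z y' ltac:(apply inH_false_iff; lia)).
        unfold harmonic_at in *.
        replace (- (x' + 1))%Z with (- x' - 1)%Z by lia.
        replace (- (x' - 1))%Z with (- x' + 1)%Z by lia. lra.
    - assert (H := halfplane_max (fun x y => F x (- y)%Z + F (- x)%Z (- y)%Z) M (2 * M)).
      simpl in H. cut (F 0%Z (- y)%Z + F (- 0)%Z (- y)%Z <= M). { simpl. lra. }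
      apply H; try assumption.
      + intros x' y' _. assert (H1 := HF x' (- y')%Z). assert (H2 := HF (- x')%Z (- y')%Z). lra.
      + intros x'. destruct (Z_le_gt_dec x' 0).
        * assert (H1 := H0 x' 0%Z ltac:(apply inH_true_iff; lia)).
          assert (H2 := HF (- x')%Z 0%Z). lra.
        * assert (H1 := H0 (- x')%Z 0%Z ltac:(apply inH_true_iff; lia)).
          assert (H2 := HF x' 0%Z). lra.
      + intros x' y' Hy'.
        assert (E1 := Hh x' (- y')%Z ltac:(apply inH_false_iff; lia)).
        assert (E2 := Hh (- x')%Z (- y')%Z ltac:(apply inH_false_iff; lia)).
        unfold harmonic_at in *.
        replace (- (x' + 1))%Z with (- x' - 1)%Z by lia.
        replace (- (x' - 1))%Z with (- x' + 1)%Z by lia.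
        replace (- (y' + 1))%Z with (- y' - 1)%Z by lia.
        replace (- (y' - 1))%Z with (- y' + 1)%Z by lia. lra. }
  assert (Hright : forall x y, (0 <= x)%Z -> F x y <= M / 2).
  { intros x y Hx.
    (* The coordinates are exchanged, the column $x=0$ being the boundary line. *)
    apply (halfplane_max (fun y x => F x y) (M / 2) M); try assumption.
    - intros; apply HF.
    - intros y'. destruct (Z_le_gt_dec 0 y').
      + apply Hcol; lia.
      + replace y' with (- (- y'))%Z by lia. apply Hcol; lia.
    - intros y' x' Hx'. assert (E := Hh x' y' ltac:(apply inH_false_iff; lia)).
      unfold harmonic_at in *. lra. }
  assert (Haxis : forall x, F x 0%Z <= M / 2).
  { intros x. destruct (Z_le_gt_dec x 0).
    - assert (H1 := H0 x 0%Z ltac:(apply inH_true_iff; lia)). lra.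
    - apply Hright; lia. }
  intros x y. destruct (Z_le_gt_dec 0 y) as [Hy|Hy].
  - apply (halfplane_max F (M / 2) M); try assumption.
    + intros; apply HF.
    + intros x' y' Hy'. apply Hh, inH_false_iff. lia.
  - replace y with (- (- y))%Z by lia.
    apply (halfplane_max (fun x y => F x (- y)%Z) (M / 2) M); try lia.
    + intros; apply HF.
    + exact Haxis.
    + intros x' y' Hy'. assert (E := Hh x' (- y')%Z ltac:(apply inH_false_iff; lia)).
      unfold harmonic_at in *.
      replace (- (y' + 1))%Z with (- y' - 1)%Z by lia.
      replace (- (y' - 1))%Z with (- y' + 1)%Z by lia. lra.
Qed.

(** The conclusion of [slit_max_half] is again a uniform bound, so it can be fed back; every upper
    bound shrinks geometrically to zero. *)
Theorem slit_max (F : Z -> Z -> R) (B : R) :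
  (forall x y, F x y <= B) ->
  (forall x y, inH x y = true -> F x y <= 0) ->
  (forall x y, inH x y = false -> harmonic_at F x y) ->
  forall x y, F x y <= 0.
Proof.
  intros HB H0 Hh x y.
  assert (Hn : forall n x y, F x y <= Rmax 0 B * (/ 2) ^ n).
  { induction n as [|n IH]; intros x' y'.
    - simpl. rewrite Rmult_1_r. eapply Rle_trans; [apply HB|apply Rmax_r].
    - replace (Rmax 0 B * (/ 2) ^ S n) with (Rmax 0 B * (/ 2) ^ n / 2) by (simpl; field).
      apply slit_max_half; try assumption.
      apply Rmult_le_pos; [apply Rmax_l|apply pow_le; lra]. }
  apply (is_lim_seq_le (fun _ => F x y) (fun n => Rmax 0 B * (/ 2) ^ n) (F x y) 0).
  - intros n; apply Hn.
  - apply is_lim_seq_const.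
  - replace (Finite 0) with (Rbar_mult (Rmax 0 B) 0) by (simpl; f_equal; ring).
    apply is_lim_seq_scal_l, is_lim_seq_geom. rewrite Rabs_pos_eq; lra.
Qed.

Theorem slit_unique (F : Z -> Z -> R) (B : R) :
  (forall x y, Rabs (F x y) <= B) ->
  (forall x y, inH x y = true -> F x y = 0) ->
  (forall x y, inH x y = false -> harmonic_at F x y) ->
  forall x y, F x y = 0.
Proof.
  intros HB H0 Hh x y. apply Rle_antisym.
  - apply (slit_max F B); try assumption.
    + intros x' y'. specialize (HB x' y'). apply Rabs_le_between in HB. lra.
    + intros x' y' H. rewrite H0 by exact H. lra.
  - cut (- F x y <= 0); [lra|].
    apply (slit_max (fun x y => - F x y) B).
    + intros x' y'. specialize (HB x' y'). apply Rabs_le_between in HB. lra.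
    + intros x' y' H. rewrite H0 by exact H. lra.
    + intros x' y' H. specialize (Hh x' y' H). unfold harmonic_at in *. lra.
Qed.

(** * Hitting probabilities *)

Lemma sum_n_S (u : nat -> R) (n : nat) : sum_n u (S n) = sum_n u n + u (S n).
Proof. exact (sum_Sn u n). Qed.

Lemma ex_series_bounded_pos (u : nat -> R) (B : R) :
  (forall n, 0 <= u n) -> (forall n, sum_n u n <= B) -> ex_series u.
Proof.
  intros Hu HB.
  destruct (ex_finite_lim_seq_incr (sum_n u) B) as [l Hl]; try assumption.
  - intros n. rewrite sum_n_S. specialize (Hu (S n)). lra.
  - exists l. exact Hl.
Qed.

Lemma hitq_0 (x y : Z) (k : nat) :
  hitq 0 x y k = if (inH x y && (x =? - Z.of_nat k)%Z)%bool then 1 else 0.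
Proof.
  simpl. destruct (inH x y) eqn:E; [|reflexivity].
  apply inH_true_iff in E. destruct E as [-> _]. simpl.
  rewrite Bool.andb_true_r. reflexivity.
Qed.

Lemma hitq_S_out (n : nat) (x y : Z) (k : nat) : inH x y = false ->
  hitq (S n) x y k = / 4 * (hitq n (x + 1) y k + hitq n (x - 1) y k
             + hitq n x (y + 1) k + hitq n x (y - 1) k).
Proof. intros H. simpl. rewrite H. reflexivity. Qed.

Lemma hitq_S_in (n : nat) (x y : Z) (k : nat) : inH x y = true -> hitq (S n) x y k = 0.
Proof. intros H. simpl. rewrite H. reflexivity. Qed.

Lemma hitq_ge0 (n : nat) (x y : Z) (k : nat) : 0 <= hitq n x y k.
Proof.
  revert x y; induction n as [|n IH]; intros x y.
  - rewrite hitq_0. destruct (_ && _)%bool; lra.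
  - simpl. destruct (inH x y); [lra|].
    assert (H1 := IH (x + 1)%Z y). assert (H2 := IH (x - 1)%Z y).
    assert (H3 := IH x (y + 1)%Z). assert (H4 := IH x (y - 1)%Z). lra.
Qed.

Lemma hitq_symm (n : nat) (x y : Z) (k : nat) : hitq n x (- y) k = hitq n x y k.
Proof.
  revert x y; induction n as [|n IH]; intros x y.
  - rewrite !hitq_0. unfold inH. replace (- y =? 0)%Z with (y =? 0)%Z; [reflexivity|].
    destruct (Z.eqb_spec y 0), (Z.eqb_spec (- y) 0); lia || reflexivity.
  - simpl. unfold inH. replace (- y =? 0)%Z with (y =? 0)%Z.
    2: destruct (Z.eqb_spec y 0), (Z.eqb_spec (- y) 0); lia || reflexivity.
    replace (- y + 1)%Z with (- (y - 1))%Z by lia.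
    replace (- y - 1)%Z with (- (y + 1))%Z by lia.
    rewrite !IH. destruct ((y =? 0)%Z && (x <=? 0)%Z)%bool; [reflexivity|]. lra.
Qed.

Lemma sum_hitq_in (N : nat) (x y : Z) (k : nat) : inH x y = true ->
  sum_n (fun n => hitq n x y k) N = hitq 0 x y k.
Proof.
  intros H. induction N as [|N IH].
  - apply sum_O.
  - rewrite sum_n_S, IH, hitq_S_in by exact H. apply Rplus_0_r.
Qed.

Lemma sum_hitq_S_out (N : nat) (x y : Z) (k : nat) : inH x y = false ->
  sum_n (fun n => hitq n x y k) (S N) =
  / 4 * (sum_n (fun n => hitq n (x + 1) y k) N + sum_n (fun n => hitq n (x - 1) y k) N
       + sum_n (fun n => hitq n x (y + 1) k) N + sum_n (fun n => hitq n x (y - 1) k) N).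
Proof.
  intros H. induction N as [|N IH].
  - rewrite sum_n_S, !sum_O, hitq_S_out, (hitq_0 x y), H by exact H. simpl andb. cbv iota. lra.
  - rewrite sum_n_S, IH, hitq_S_out, !(sum_n_S _ N) by exact H. lra.
Qed.

Lemma sum_hitq_le1 (N : nat) (x y : Z) (k : nat) : sum_n (fun n => hitq n x y k) N <= 1.
Proof.
  revert x y; induction N as [|N IH]; intros x y.
  - rewrite sum_O, hitq_0. destruct (_ && _)%bool; lra.
  - destruct (inH x y) eqn:E.
    + rewrite sum_hitq_in, hitq_0 by exact E. destruct (_ && _)%bool; lra.
    + rewrite sum_hitq_S_out by exact E.
      assert (H1 := IH (x + 1)%Z y). assert (H2 := IH (x - 1)%Z y).
      assert (H3 := IH x (y + 1)%Z). assert (H4 := IH x (y - 1)%Z). lra.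
Qed.

Lemma ex_series_hitq (x y : Z) (k : nat) : ex_series (fun n => hitq n x y k).
Proof.
  apply (ex_series_bounded_pos _ 1).
  - intros n; apply hitq_ge0.
  - intros n; apply sum_hitq_le1.
Qed.

Lemma is_lim_sum_hitq (x y : Z) (k : nat) :
  is_lim_seq (sum_n (fun n => hitq n x y k)) (p_hit x y k).
Proof. apply (Series_correct _ (ex_series_hitq x y k)). Qed.

Lemma p_hit_ge0 (x y : Z) (k : nat) : 0 <= p_hit x y k.
Proof.
  apply (is_lim_seq_le (fun _ => 0) (sum_n (fun n => hitq n x y k)) 0 (p_hit x y k)).
  - intros n. induction n as [|n IH]; [rewrite sum_O; apply hitq_ge0|].
    rewrite sum_n_S.
    assert (H := hitq_ge0 (S n) x y k). apply Rplus_le_le_0_compat; assumption.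
  - apply is_lim_seq_const.
  - apply is_lim_sum_hitq.
Qed.

Lemma p_hit_le1 (x y : Z) (k : nat) : p_hit x y k <= 1.
Proof.
  apply (is_lim_seq_le (sum_n (fun n => hitq n x y k)) (fun _ => 1) (p_hit x y k) 1).
  - intros n. apply sum_hitq_le1.
  - apply is_lim_sum_hitq.
  - apply is_lim_seq_const.
Qed.

Lemma p_hit_symm (x y : Z) (k : nat) : p_hit x (- y) k = p_hit x y k.
Proof. apply Series_ext. intros n. apply hitq_symm. Qed.

Lemma p_hit_abs (x y : Z) (k : nat) : p_hit x (Z.abs y) k = p_hit x y k.
Proof. destruct (Z.abs_eq_or_opp y) as [-> | ->]; [reflexivity | apply p_hit_symm]. Qed.

Lemma p_hit_in (x y : Z) (k : nat) : inH x y = true ->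
  p_hit x y k = if (x =? - Z.of_nat k)%Z then 1 else 0.
Proof.
  intros H. unfold p_hit. apply is_series_unique.
  apply (is_lim_seq_ext (fun _ => hitq 0 x y k) _ (Finite (if (x =? - Z.of_nat k)%Z then 1 else 0))).
  - intros n. symmetry. apply sum_hitq_in. exact H.
  - rewrite hitq_0, H. apply (is_lim_seq_const (if (x =? - Z.of_nat k)%Z then 1 else 0)).
Qed.

Lemma p_hit_slit (x : Z) (k : nat) : (x <= 0)%Z ->
  p_hit x 0 k = if (x =? - Z.of_nat k)%Z then 1 else 0.
Proof. intros H. apply p_hit_in, inH_true_iff. lia. Qed.

Lemma p_hit_harmonic (x y : Z) (k : nat) : inH x y = false ->
  harmonic_at (fun x y => p_hit x y k) x y.
Proof.
  intros H. unfold harmonic_at.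
  assert (L := is_lim_sum_hitq x y k). apply is_lim_seq_incr_1 in L.
  cut (Finite (p_hit x y k) = Finite (/ 4 * (p_hit (x + 1) y k + p_hit (x - 1) y k
       + p_hit x (y + 1) k + p_hit x (y - 1) k))).
  { intros E. injection E as E. lra. }
  apply is_lim_seq_unique in L. rewrite <- L.
  apply is_lim_seq_unique.
  eapply is_lim_seq_ext.
  { intros n. symmetry. apply sum_hitq_S_out. exact H. }
  apply (is_lim_seq_scal_l _ (/ 4) (Finite _)).
  repeat (apply is_lim_seq_plus'; [|apply is_lim_sum_hitq]).
  apply is_lim_sum_hitq.
Qed.

Lemma p_hit_Rabs_le1 (x y : Z) (k : nat) : Rabs (p_hit x y k) <= 1.
Proof.
  apply Rabs_le. assert (H0 := p_hit_ge0 x y k). assert (H1 := p_hit_le1 x y k). lra.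
Qed.

(** The maximum principle applies to the partial sum minus 1, whose values on the slit are 0 or -1.
    The crude bound [INR (S K)] only provides boundedness. *)
Lemma sum_p_hit_le1 (K : nat) (x y : Z) : sum_n (p_hit x y) K <= 1.
Proof.
  cut (sum_n (p_hit x y) K - 1 <= 0); [lra|].
  apply (slit_max (fun x y => sum_n (p_hit x y) K - 1) (INR (S K))).
  - intros x' y'. cut (sum_n (p_hit x' y') K <= INR (S K)); [lra|].
    induction K as [|K IH].
    + rewrite sum_O. apply p_hit_le1.
    + rewrite sum_n_S, S_INR. apply Rplus_le_compat; [exact IH|apply p_hit_le1].
  - intros x' y' H. cut (sum_n (p_hit x' y') K = if (- x' <=? Z.of_nat K)%Z then 1 else 0).
    { intros ->. destruct (_ <=? _)%Z; lra. }
    induction K as [|K IH].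
    + rewrite sum_O, p_hit_in by exact H. apply inH_true_iff in H.
      destruct (Z.eqb_spec x' (- Z.of_nat 0)), (Z.leb_spec (- x') (Z.of_nat 0)); lia || reflexivity.
    + rewrite sum_n_S, IH, p_hit_in by exact H. apply inH_true_iff in H.
      
      destruct (Z.eqb_spec x' (- Z.of_nat (S K))), (Z.leb_spec (- x') (Z.of_nat K)),
       (Z.leb_spec (- x') (Z.of_nat (S K))); try lia; simpl; lra.
  - intros x' y' H. unfold harmonic_at.
    cut (harmonic_at (fun x y => sum_n (p_hit x y) K) x' y'); [unfold harmonic_at; lra|].
    induction K as [|K IH]; unfold harmonic_at.
    + rewrite !sum_O. apply p_hit_harmonic. exact H.
    + rewrite !sum_n_S. unfold harmonic_at in IH.
      assert (E := p_hit_harmonic x' y' (S K) H). unfold harmonic_at in E.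
      lra.
Qed.

Lemma ex_series_p_hit (x y : Z) : ex_series (p_hit x y).
Proof.
  apply (ex_series_bounded_pos _ 1).
  - intros n; apply p_hit_ge0.
  - intros n; apply sum_p_hit_le1.
Qed.

(** The defect from 1 is bounded, harmonic off the slit and zero on it. Almost sure finiteness of
    the hitting time is thus a consequence of uniqueness; at $(1,0)$ it becomes $D(1)=0$. *)
Theorem Series_p_hit (x y : Z) : Series (p_hit x y) = 1.
Proof.
  cut (1 - Series (p_hit x y) = 0); [lra|].
  assert (Hb : forall x y, 0 <= Series (p_hit x y) <= 1).
  { intros x' y'.
    assert (L := Series_correct _ (ex_series_p_hit x' y')). split.
    - eapply Rle_trans; [apply (p_hit_ge0 x' y' 0)|].
      apply (is_lim_seq_le (fun _ => p_hit x' y' 0) (sum_n (p_hit x' y')) (p_hit x' y' 0)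
              (Series (p_hit x' y'))).
      + intros n. induction n as [|n IH]; [rewrite sum_O; lra|].
        rewrite sum_n_S. assert (H := p_hit_ge0 x' y' (S n)). lra.
      + apply is_lim_seq_const.
      + exact L.
    - apply (is_lim_seq_le (sum_n (p_hit x' y')) (fun _ => 1) (Series (p_hit x' y')) 1).
      + intros n; apply sum_p_hit_le1.
      + exact L.
      + apply is_lim_seq_const. }
  apply (slit_unique (fun x y => 1 - Series (p_hit x y)) 1).
  - intros x' y'. apply Rabs_le. specialize (Hb x' y'). lra.
  - intros x' y' H. rewrite (is_series_unique _ 1); [ring|].
    apply (is_lim_seq_ext_loc (fun _ => 1) _ (Finite 1)); [|apply is_lim_seq_const].
    exists (Z.to_nat (- x')). intros n Hn. symmetry.
    cut (sum_n (p_hit x' y') n = if (- x' <=? Z.of_nat n)%Z then 1 else 0).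
    { intros E. refine (eq_trans E _).
      destruct (Z.leb_spec (- x') (Z.of_nat n)); [reflexivity|lia]. }
    clear Hn. induction n as [|K IH].
    + rewrite sum_O, p_hit_in by exact H. apply inH_true_iff in H.
      destruct (Z.eqb_spec x' (- Z.of_nat 0)), (Z.leb_spec (- x') (Z.of_nat 0)); lia || reflexivity.
    + rewrite sum_n_S, IH, p_hit_in by exact H. apply inH_true_iff in H.
      destruct (Z.eqb_spec x' (- Z.of_nat (S K))), (Z.leb_spec (- x') (Z.of_nat K)),
       (Z.leb_spec (- x') (Z.of_nat (S K))); try lia; simpl; lra.
  - intros x' y' H. unfold harmonic_at.
    cut (Series (p_hit x' y') = / 4 * (Series (p_hit (x' + 1) y') + Series (p_hit (x' - 1) y')
        + Series (p_hit x' (y' + 1)) + Series (p_hit x' (y' - 1)))); [lra|].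
    rewrite <- !Series_plus, <- Series_scal_l; repeat apply (ex_series_plus (V:=R_NormedModule));
      try apply ex_series_p_hit.
    apply Series_ext. intros n. assert (E := p_hit_harmonic x' y' n H).
    unfold harmonic_at in E. lra.
Qed.

(* Strong Markov property at the first entry into the slit enlarged by the point (1,0), shifted by one. *)
Theorem p_hit_shift (x y : Z) (k : nat) :
  p_hit (x + 1) y k = p_hit x y (S k) + p_hit x y 0 * p_hit 1 0 k.
Proof.
  cut (p_hit x y (S k) + p_hit x y 0 * p_hit 1 0 k - p_hit (x + 1) y k = 0); [lra|].
  apply (slit_unique (fun x y => p_hit x y (S k) + p_hit x y 0 * p_hit 1 0 k
                                 - p_hit (x + 1) y k) 2).
  - intros x' y'. apply Rabs_le.
    assert (H1 := p_hit_ge0 x' y' (S k)). assert (H1' := p_hit_le1 x' y' (S k)).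
    assert (H2 := p_hit_ge0 x' y' 0). assert (H2' := p_hit_le1 x' y' 0).
    assert (H3 := p_hit_ge0 1 0 k). assert (H3' := p_hit_le1 1 0 k).
    assert (H4 := p_hit_ge0 (x' + 1) y' k). assert (H4' := p_hit_le1 (x' + 1) y' k).
    assert (H5 := Rmult_le_pos _ _ H2 H3).
    assert (H6 := Rmult_le_compat _ _ _ _ H2 H3 H2' H3'). lra.
  - intros x' y' H. rewrite !(p_hit_in x') by exact H. apply inH_true_iff in H.
    destruct H as [-> H].
    destruct (Z.eqb_spec x' (- Z.of_nat (S k))), (Z.eqb_spec x' (- Z.of_nat 0)); try lia.
    + rewrite (p_hit_slit (x' + 1)) by lia.
      destruct (Z.eqb_spec (x' + 1) (- Z.of_nat k)); try lia. ring.
    + subst x'. simpl. ring.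
    + rewrite (p_hit_slit (x' + 1)) by lia.
      destruct (Z.eqb_spec (x' + 1) (- Z.of_nat k)); try lia. ring.
  - intros x' y' H.
    assert (E1 := p_hit_harmonic x' y' (S k) H). assert (E2 := p_hit_harmonic x' y' 0 H).
    assert (E3 := p_hit_harmonic (x' + 1) y' k).
    assert (H' : inH (x' + 1) y' = false) by (apply inH_false_iff; apply inH_false_iff in H; lia).
    specialize (E3 H'). unfold harmonic_at in *.
    replace (x' + 1 - 1)%Z with (x' - 1 + 1)%Z in E3 by lia.
    replace (4 * (p_hit x' y' (S k) + p_hit x' y' 0 * p_hit 1 0 k - p_hit (x' + 1) y' k))
      with (4 * p_hit x' y' (S k) + 4 * p_hit x' y' 0 * p_hit 1 0 k - 4 * p_hit (x' + 1) y' k) by ring.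
    rewrite E1, E2, E3. ring.
Qed.

(** * Time reversal and the harmonic conjugate *)

Definition nbr (F : Z -> Z -> R) (x y : Z) : R :=
  F (x + 1)%Z y + F (x - 1)%Z y + F x (y + 1)%Z + F x (y - 1)%Z.

Definition kron (x x' : Z) : R := if (x =? x')%Z then 1 else 0.

Definition offH (x y : Z) : R := if inH x y then 0 else 1.

(* Probability that the n-step walk goes from (x,y) to (x',y') without ever being in H. *)
Fixpoint walkH (n : nat) (x y x' y' : Z) : R :=
  match n with
  | O => offH x y * (kron x x' * kron y y')
  | S n' => offH x y * (/ 4 * nbr (fun a b => walkH n' a b x' y') x y)
  end.

Lemma kron_sym (x x' : Z) : kron x x' = kron x' x.
Proof. unfold kron. rewrite Z.eqb_sym. reflexivity. Qed.

Lemma kron_add (x x' c : Z) : kron (x + c) x' = kron x (x' - c).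
Proof.
  unfold kron. destruct (Z.eqb_spec (x + c) x'), (Z.eqb_spec x (x' - c)); lia || reflexivity.
Qed.

Lemma kron_sub (x x' c : Z) : kron (x - c) x' = kron x (x' + c).
Proof.
  unfold kron. destruct (Z.eqb_spec (x - c) x'), (Z.eqb_spec x (x' + c)); lia || reflexivity.
Qed.

Lemma offH_kron (x y x' y' : Z) :
  offH x y * (kron x x' * kron y y') = offH x' y' * (kron x x' * kron y y').
Proof.
  unfold kron. destruct (Z.eqb_spec x x') as [-> |], (Z.eqb_spec y y') as [-> |]; ring.
Qed.

(** Peeling off the last step instead of the first; the symmetry of the kernel comes from comparing
    the two recursions. *)
Lemma walkH_last (n : nat) (x y x' y' : Z) :
  walkH (S n) x y x' y' = offH x' y' * (/ 4 * nbr (fun a b => walkH n x y a b) x' y').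
Proof.
  revert x y; induction n as [|n IH]; intros x y.
  - simpl walkH. unfold nbr. rewrite !kron_add, !kron_sub.
    assert (Hk : forall a b, offH a b * (kron a x' * kron b y') = offH x' y' * (kron a x' * kron b y'))
      by (intros; apply offH_kron).
    assert (E1 := Hk (x + 1)%Z y). assert (E2 := Hk (x - 1)%Z y).
    assert (E3 := Hk x (y + 1)%Z). assert (E4 := Hk x (y - 1)%Z).
    rewrite !kron_add, !kron_sub in *. rewrite E1, E2, E3, E4. ring.
  - change (walkH (S (S n)) x y x' y')
      with (offH x y * (/ 4 * nbr (fun a b => walkH (S n) a b x' y') x y)).
    unfold nbr at 1. rewrite !IH. unfold nbr.
    change (walkH (S n) x y) with
      (fun a' b' => offH x y * (/ 4 * nbr (fun a b => walkH n a b a' b') x y)).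
    cbv beta. unfold nbr. ring.
Qed.

Lemma walkH_sym (n : nat) (x y x' y' : Z) : walkH n x y x' y' = walkH n x' y' x y.
Proof.
  revert x y x' y'; induction n as [|n IH]; intros x y x' y'.
  - simpl. rewrite offH_kron, (kron_sym x), (kron_sym y). reflexivity.
  - rewrite walkH_last. simpl walkH. unfold nbr.
    rewrite (IH x y (x' + 1)%Z), (IH x y (x' - 1)%Z), (IH x y x' (y' + 1)%Z), (IH x y x' (y' - 1)%Z).
    reflexivity.
Qed.

Lemma hitq_0_kron (x y : Z) (k : nat) : hitq 0 x y k = kron x (- Z.of_nat k) * kron y 0.
Proof.
  rewrite hitq_0. unfold kron, inH.
  destruct (Z.eqb_spec x (- Z.of_nat k)), (Z.eqb_spec y 0), (Z.leb_spec x 0);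
    try lia; simpl; ring.
Qed.

(** A path entering $H$ at time $n+1$ stays off $H$ up to time $n$ and then steps onto $(-k,0)$.
    Neighbours of that point inside $H$ contribute nothing, since [walkH] vanishes as soon as an
    endpoint is in $H$. *)
Lemma hitq_walkH (n : nat) (x y : Z) (k : nat) :
  hitq (S n) x y k = / 4 * nbr (fun a b => walkH n x y a b) (- Z.of_nat k) 0.
Proof.
  assert (HS : forall n x y, hitq (S n) x y k = offH x y * (/ 4 * nbr (fun a b => hitq n a b k) x y)).
  { intros n' x' y'. simpl. unfold offH. destruct (inH x' y'); unfold nbr; ring. }
  revert x y; induction n as [|n IH]; intros x y.
  - rewrite HS. unfold nbr. rewrite !hitq_0_kron. cbn [walkH].
    rewrite !kron_add, !kron_sub. ring.
  - rewrite HS. unfold nbr at 1. rewrite !IH. unfold nbr.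
    change (walkH (S n) x y) with
      (fun a' b' => offH x y * (/ 4 * nbr (fun a b => walkH n a b a' b') x y)).
    cbv beta. unfold nbr. ring.
Qed.

(** Up to a factor 4, both sides weigh the walks of length $n+1$ between $(-m,0)$ and $(-k,0)$ that
    are off $H$ strictly between their ends, and a reversed walk has the same weight. For $n=0$
    these are single steps along the slit. *)
Lemma hitq_nbr_symm (n k m : nat) :
  nbr (fun x y => hitq n x y k) (- Z.of_nat m) 0 = nbr (fun x y => hitq n x y m) (- Z.of_nat k) 0.
Proof.
  destruct n as [|n].
  - unfold nbr. rewrite !hitq_0_kron, !kron_add, !kron_sub.
    rewrite (kron_sym (- Z.of_nat m) (- Z.of_nat k - 1)), <- kron_add.
    rewrite (kron_sym (- Z.of_nat m) (- Z.of_nat k + 1)), <- kron_sub.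
    rewrite (kron_sym (- Z.of_nat m) (- Z.of_nat k)), !kron_add, !kron_sub. ring.
  - assert (E : forall k m, nbr (fun x y => hitq (S n) x y k) (- Z.of_nat m) 0
        = / 4 * nbr (fun x y => nbr (fun a b => walkH n x y a b) (- Z.of_nat k) 0) (- Z.of_nat m) 0).
    { intros k' m'. unfold nbr at 1. rewrite !hitq_walkH. unfold nbr. ring. }
    rewrite (E k m).
    transitivity (/ 4 * nbr (fun x y => nbr (fun a b => walkH n a b x y) (- Z.of_nat k) 0)
                      (- Z.of_nat m) 0).
    { unfold nbr. repeat (f_equal; try apply walkH_sym). }
    rewrite E. unfold nbr. ring.
Qed.

(* Time reversal of the excursions from H to H. *)
Theorem p_hit_nbr_symm (k m : nat) :
  nbr (fun x y => p_hit x y k) (- Z.of_nat m) 0 = nbr (fun x y => p_hit x y m) (- Z.of_nat k) 0.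
Proof.
  assert (HS : forall k x y, nbr (fun x y => p_hit x y k) x y
               = Series (fun n => nbr (fun x y => hitq n x y k) x y)).
  { intros j x y. unfold nbr, p_hit.
    rewrite !Series_plus; repeat apply (ex_series_plus (V := R_NormedModule));
      try apply ex_series_hitq. reflexivity. }
  rewrite !HS. apply Series_ext. intros n. apply hitq_nbr_symm.
Qed.

Definition p0 (x y : Z) : R := p_hit x y 0.

(* On the axis, [conj0] is the Laplacian of p0; off the axis it is the vertical central
   difference.  It is the discrete analogue of the harmonic conjugate: harmonic off the axis,
   with Dirichlet and Neumann data exchanged. *)
Definition conj0 (x y : Z) : R :=
  if (y =? 0)%Z then nbr p0 x 0 - 4 * p0 x 0
  else p0 x (Z.abs y + 1) - p0 x (Z.abs y - 1).

Lemma p0_harmonic (x y : Z) : inH x y = false -> harmonic_at p0 x y.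
Proof. apply p_hit_harmonic. Qed.

Lemma p0_opp (x y : Z) : p0 x (- y) = p0 x y.
Proof. apply p_hit_symm. Qed.

Lemma p0_abs (x y : Z) : p0 x (Z.abs y) = p0 x y.
Proof. apply p_hit_abs. Qed.

Lemma p0_neg (x : Z) : (x < 0)%Z -> p0 x 0 = 0.
Proof.
  intros H. unfold p0. rewrite p_hit_slit by lia.
  destruct (Z.eqb_spec x (- Z.of_nat 0)); [simpl in *; lia|reflexivity].
Qed.

Lemma p0_00 : p0 0 0 = 1.
Proof. unfold p0. rewrite p_hit_slit by lia. reflexivity. Qed.

Lemma conj0_opp (x y : Z) : conj0 x (- y) = conj0 x y.
Proof.
  unfold conj0. rewrite Z.abs_opp.
  destruct (Z.eqb_spec y 0), (Z.eqb_spec (- y) 0); lia || reflexivity.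
Qed.

Lemma conj0_axis (x : Z) :
  conj0 x 0 = p0 (x + 1) 0 + p0 (x - 1) 0 + 2 * p0 x 1 - 4 * p0 x 0.
Proof.
  unfold conj0, nbr. simpl (0 =? 0)%Z. cbv iota.
  change (0 + 1)%Z with 1%Z. change (0 - 1)%Z with (- (1))%Z. rewrite p0_opp. ring.
Qed.

Lemma conj0_pos (x y : Z) : (0 < y)%Z -> conj0 x y = p0 x (y + 1) - p0 x (y - 1).
Proof.
  intros H. unfold conj0. destruct (Z.eqb_spec y 0); [lia|].
  rewrite Z.abs_eq by lia. reflexivity.
Qed.

Lemma conj0_harmonic (x y : Z) : y <> 0%Z -> harmonic_at conj0 x y.
Proof.
  assert (Hp : forall y, (0 < y)%Z -> harmonic_at conj0 x y).
  { clear y. intros y Hy. unfold harmonic_at. rewrite !(conj0_pos _ y) by lia.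
    rewrite (conj0_pos x (y + 1)) by lia.
    assert (E := p0_harmonic x (y + 1) ltac:(apply inH_false_iff; lia)).
    unfold harmonic_at in E.
    replace (y + 1 - 1)%Z with y in * by lia.
    destruct (Z.eq_dec y 1) as [-> |Hy1].
    (* The row below is the axis, where [p0] need not be harmonic. There [conj0] is [p0 x 1] minus
       the value at $(x,-1)$ of the harmonic continuation of the upper values, exactly what
       harmonicity at height 1 demands. *)
    - change (1 - 1)%Z with 0%Z in *. change (1 + 1)%Z with 2%Z in *.
      rewrite conj0_axis. lra.
    - rewrite (conj0_pos x (y - 1)) by lia.
      assert (E' := p0_harmonic x (y - 1) ltac:(apply inH_false_iff; lia)).
      unfold harmonic_at in E'. replace (y - 1 + 1)%Z with y in * by lia. lra. }
  intros Hy. destruct (Z_le_gt_dec 0 y).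
  - apply Hp. lia.
  - assert (E := Hp (- y)%Z ltac:(lia)). unfold harmonic_at in *.
    replace (- y + 1)%Z with (- (y - 1))%Z in E by lia.
    replace (- y - 1)%Z with (- (y + 1))%Z in E by lia.
    rewrite !conj0_opp in E. lra.
Qed.

(* (T - T^-1)^2 = L^2 - 4, where L = 4 - X - X^-1 = T + T^-1 on harmonic functions. *)
Lemma conj0_laplacian (x : Z) :
  nbr conj0 x 0 - 4 * conj0 x 0
  = p0 (x + 2) 0 + p0 (x - 2) 0 - 8 * p0 (x + 1) 0 - 8 * p0 (x - 1) 0 + 14 * p0 x 0.
Proof.
  unfold nbr. change (0 + 1)%Z with 1%Z. change (0 - 1)%Z with (- (1))%Z.
  rewrite conj0_opp, !conj0_axis, (conj0_pos x 1) by lia.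
  replace (x + 1 + 1)%Z with (x + 2)%Z by lia. replace (x + 1 - 1)%Z with x by lia.
  replace (x - 1 + 1)%Z with x by lia. replace (x - 1 - 1)%Z with (x - 2)%Z by lia.
  assert (E := p0_harmonic x 1 ltac:(apply inH_false_iff; lia)). unfold harmonic_at in E.
  change (1 + 1)%Z with 2%Z in *. change (1 - 1)%Z with 0%Z in *. lra.
Qed.

Lemma conj0_axis_pos (x : Z) : (0 < x)%Z -> conj0 x 0 = 0.
Proof.
  intros H. unfold conj0. simpl (0 =? 0)%Z. cbv iota.
  assert (E := p0_harmonic x 0 ltac:(apply inH_false_iff; lia)). unfold harmonic_at in E.
  unfold nbr. lra.
Qed.

Lemma conj0_bounded (x y : Z) : Rabs (conj0 x y) <= 4.
Proof.
  assert (H0 : forall x y, 0 <= p0 x y <= 1).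
  { intros; split; [apply p_hit_ge0|apply p_hit_le1]. }
  apply Rabs_le. unfold conj0, nbr. destruct (y =? 0)%Z.
  - assert (H1 := H0 (x + 1)%Z 0%Z). assert (H2 := H0 (x - 1)%Z 0%Z).
    assert (H3 := H0 x (0 + 1)%Z). assert (H4 := H0 x (0 - 1)%Z). assert (H5 := H0 x 0%Z). lra.
  - assert (H1 := H0 x (Z.abs y + 1)%Z). assert (H2 := H0 x (Z.abs y - 1)%Z). lra.
Qed.

(** Matching the reflection identity on the axis at $x=-2,-1,0$ gives a triangular system, because
    [p0] is 1 at the origin and 0 to its left on the axis. The three constants are its solution. *)
Definition conj_c0 : R := conj0 0 0.
Definition conj_c1 : R := conj0 (-1) 0 - conj_c0 * p0 1 0.
Definition conj_c2 : R := conj0 (-2) 0 - conj_c0 * p0 2 0 - conj_c1 * p0 1 0.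

(* Reflected, the conjugate vanishes on a half-line and is harmonic off it up to three points,
   as are three translates of p0. *)
Theorem conj0_reflection (x y : Z) :
  conj0 (-2 - x) y = conj_c0 * p0 (x + 2) y + conj_c1 * p0 (x + 1) y + conj_c2 * p0 x y.
Proof.
  cut (conj0 (-2 - x) y - (conj_c0 * p0 (x + 2) y + conj_c1 * p0 (x + 1) y + conj_c2 * p0 x y) = 0);
    [lra|].
  apply (slit_unique (fun x y => conj0 (-2 - x) y
     - (conj_c0 * p0 (x + 2) y + conj_c1 * p0 (x + 1) y + conj_c2 * p0 x y))
     (4 + (Rabs conj_c0 + Rabs conj_c1 + Rabs conj_c2))).
  - intros x' y'. eapply Rle_trans; [apply Rabs_triang|]. rewrite Rabs_Ropp.
    apply Rplus_le_compat; [apply conj0_bounded|].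
    assert (H0 : forall c x y, Rabs (c * p0 x y) <= Rabs c).
    { intros c a b. rewrite Rabs_mult. rewrite <- (Rmult_1_r (Rabs c)) at 2.
      apply Rmult_le_compat_l; [apply Rabs_pos|apply p_hit_Rabs_le1]. }
    eapply Rle_trans; [apply Rabs_triang|]. apply Rplus_le_compat; [|apply H0].
    eapply Rle_trans; [apply Rabs_triang|]. apply Rplus_le_compat; apply H0.
  - intros x' y' H. apply inH_true_iff in H. destruct H as [-> H].
    destruct (Z_lt_ge_dec x' (-2)).
    { rewrite conj0_axis_pos, !p0_neg by lia. ring. }
    assert (H' : x' = (-2)%Z \/ x' = (-1)%Z \/ x' = 0%Z) by lia.
    destruct H' as [-> | [-> | ->]].
    + change (-2 - -2)%Z with 0%Z. change (-2 + 2)%Z with 0%Z. change (-2 + 1)%Z with (-1)%Z.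
      rewrite p0_00, !p0_neg by lia. unfold conj_c0. ring.
    + change (-2 - -1)%Z with (-1)%Z. change (-1 + 2)%Z with 1%Z. change (-1 + 1)%Z with 0%Z.
      rewrite p0_00, (p0_neg (-1)) by lia. unfold conj_c1. ring.
    + change (-2 - 0)%Z with (-2)%Z. change (0 + 2)%Z with 2%Z. change (0 + 1)%Z with 1%Z.
      rewrite p0_00. unfold conj_c2. ring.
  - intros x' y' H.
    assert (E0 := p0_harmonic x' y' H).
    assert (E1 := p0_harmonic (x' + 1) y').
    assert (E2 := p0_harmonic (x' + 2) y').
    apply inH_false_iff in H.
    specialize (E1 ltac:(apply inH_false_iff; lia)).
    specialize (E2 ltac:(apply inH_false_iff; lia)).
    (* Off the slit on the axis means $x'>0$; the five values of [p0] in [conj0_laplacian] then have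
       abscissas at most $-x'<0$ and vanish. The 2 in the reflection is the reach of that difference
       operator. *)
    assert (E3 : harmonic_at conj0 (-2 - x') y').
    { destruct (Z.eq_dec y' 0) as [-> |Hy]; [|apply conj0_harmonic; exact Hy].
      assert (E := conj0_laplacian (-2 - x')). rewrite !p0_neg in E by lia.
      unfold harmonic_at. unfold nbr in E. lra. }
    unfold harmonic_at in *.
    replace (-2 - (x' + 1))%Z with (-2 - x' - 1)%Z by lia.
    replace (-2 - (x' - 1))%Z with (-2 - x' + 1)%Z by lia.
    replace (x' + 1 + 2)%Z with (x' + 2 + 1)%Z by lia.
    replace (x' - 1 + 2)%Z with (x' + 2 - 1)%Z by lia.
    replace (x' - 1 + 1)%Z with (x' + 1 - 1)%Z by lia.
    set (c0 := conj_c0). set (c1 := conj_c1). set (c2 := conj_c2).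
    replace (4 * (conj0 (-2 - x') y' - (c0 * p0 (x' + 2) y' + c1 * p0 (x' + 1) y' + c2 * p0 x' y')))
      with (4 * conj0 (-2 - x') y' - (c0 * (4 * p0 (x' + 2) y') + c1 * (4 * p0 (x' + 1) y')
              + c2 * (4 * p0 x' y'))) by ring.
    rewrite E0, E1, E2, E3. ring.
Qed.

Definition q_coef (k : nat) : R := p_hit 1 0 k.

(** Time reversal moves the neighbour sum from $(-k-1,0)$ to the origin, with target $k+1$. There
    [p_hit_shift] turns it into the neighbour sum at $(1,0)$ with target $k$, which is $4q_k$ by
    harmonicity, minus $q_k$ times the neighbour sum of [p0] at the origin, which is $4+c_0$ for
    $c_0$ = [conj_c0]. *)
Lemma conj0_reversal (k : nat) : conj0 (- Z.of_nat (S k)) 0 = - conj_c0 * q_coef k.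
Proof.
  unfold conj0 at 1. simpl (0 =? 0)%Z. cbv iota.
  rewrite p0_neg by lia. unfold p0 at 1.
  assert (E := p_hit_nbr_symm 0 (S k)).
  change (nbr (fun x y => p_hit x y 0) (- Z.of_nat (S k)) 0 - 4 * 0 = - conj_c0 * q_coef k).
  rewrite E. change (- Z.of_nat 0)%Z with 0%Z. unfold nbr.
  assert (S1 := fun x y => p_hit_shift x y k).
  assert (S2 : forall x y, p_hit x y (S k) = p_hit (x + 1) y k - p0 x y * q_coef k).
  { intros x y. rewrite S1. unfold p0, q_coef. ring. }
  rewrite !S2. unfold conj_c0, conj0, nbr. simpl (0 =? 0)%Z. cbv iota. rewrite p0_00.
  assert (Eh := p_hit_harmonic 1 0 k ltac:(apply inH_false_iff; lia)). unfold harmonic_at in Eh.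
  replace (0 + 1 + 1)%Z with (1 + 1)%Z by lia. replace (0 - 1 + 1)%Z with (1 - 1)%Z by lia.
  replace (p_hit 1 0 k) with (q_coef k) in Eh by reflexivity.
  change (0 + 1)%Z with 1%Z in *. change (0 - 1)%Z with (-1)%Z in *.
  nra.
Qed.

(** * The quadratic equation for D *)

(* Coefficients of D and of its inverse. *)
Definition d_coef (k : nat) : R := match k with O => 1 | S k' => - q_coef k' end.
Definition a_coef (k : nat) : R := p0 (Z.of_nat k) 0.

(** At $(j,0)$ the shift relation says that [a_coef j * d_coef (S m)] equals [p_hit j 0 (S m)] minus
    [p_hit (j + 1) 0 m]. The sum telescopes along the axis, the target index falling by one as the
    starting point moves right. *)
Lemma sum_a_d (n j : nat) : (j < n)%nat ->
  sum_f_R0 (fun k => a_coef k * d_coef (n - k)) j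
  = p_hit 0 0 n - p_hit (Z.of_nat j + 1) 0 (n - S j).
Proof.
  intros Hj. induction j as [|j IH]; [cbn [sum_f_R0]|rewrite tech5].
  - replace (n - 0)%nat with (S (n - 1)) by lia.
    change (Z.of_nat 0 + 1)%Z with (0 + 1)%Z. rewrite p_hit_shift. unfold a_coef, d_coef.
    change (Z.of_nat 0) with 0%Z. unfold p0, q_coef. replace (S (n - 1)) with n by lia. ring.
  - rewrite IH by lia. replace (n - S j)%nat with (S (n - S (S j))) by lia.
    replace (Z.of_nat j + 1)%Z with (Z.of_nat (S j)) by lia.
    rewrite (p_hit_shift (Z.of_nat (S j))). unfold a_coef, d_coef, p0, q_coef. ring.
Qed.

Lemma a_mult_d (n : nat) : PS_mult a_coef d_coef n = match n with O => 1 | _ => 0 end.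
Proof.
  unfold PS_mult. destruct n as [|n].
  - simpl. replace (a_coef 0) with 1 by (symmetry; apply p0_00). ring.
  - rewrite tech5, sum_a_d by lia.
    replace (S n - S n)%nat with 0%nat by lia.
    replace (Z.of_nat n + 1)%Z with (Z.of_nat (S n)) by lia.
    rewrite (p_hit_slit 0) by lia.
    destruct (Z.eqb_spec 0 (- Z.of_nat (S n))); [lia|].
    unfold a_coef, d_coef, p0. ring.
Qed.

Lemma PS_mult_incr_1 (u v : nat -> R) (n : nat) :
  PS_mult (PS_incr_1 u) v n = PS_incr_1 (PS_mult u v) n.
Proof.
  unfold PS_mult. destruct n as [|n]; simpl PS_incr_1.
  - simpl. unfold zero; simpl. ring.
  - rewrite decomp_sum by lia. simpl PS_incr_1. unfold zero; simpl (AbelianMonoid.zero _ _).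
    simpl pred. rewrite Rmult_0_l, Rplus_0_l. reflexivity.
Qed.

Lemma d_eq_a (k : nat) :
  conj_c0 * d_coef k = conj_c0 * a_coef k + conj_c1 * PS_incr_1 a_coef k
                  + conj_c2 * PS_incr_1 (PS_incr_1 a_coef) k.
Proof.
  assert (E : conj_c0 * d_coef k = conj0 (- Z.of_nat k) 0).
  { destruct k as [|k]; [simpl; unfold conj_c0; ring|].
    rewrite conj0_reversal. simpl. ring. }
  rewrite E. replace (- Z.of_nat k)%Z with (-2 - (Z.of_nat k - 2))%Z by lia.
  rewrite conj0_reflection.
  replace (Z.of_nat k - 2 + 2)%Z with (Z.of_nat k) by lia.
  replace (Z.of_nat k - 2 + 1)%Z with (Z.of_nat k - 1)%Z by lia.
  assert (I : forall j, p0 (Z.of_nat j - 1) 0 = PS_incr_1 a_coef j).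
  { intros [|j]; simpl PS_incr_1.
    - apply p0_neg. lia.
    - unfold a_coef. f_equal. lia. }
  rewrite I. f_equal. f_equal.
  destruct k as [|k].
  - apply p0_neg. lia.
  - replace (Z.of_nat (S k) - 2)%Z with (Z.of_nat k - 1)%Z by lia. rewrite I. reflexivity.
Qed.

(** Multiplying [d_eq_a] by $D$ and using $AD=1$ leaves only the quadratic polynomial. *)
Lemma d_mult_d_c (n : nat) :
  conj_c0 * PS_mult d_coef d_coef n = match n with O => conj_c0 | 1%nat => conj_c1 | 2%nat => conj_c2 | _ => 0 end.
Proof.
  assert (E : conj_c0 * PS_mult d_coef d_coef n = conj_c0 * PS_mult a_coef d_coef n
     + conj_c1 * PS_mult (PS_incr_1 a_coef) d_coef n + conj_c2 * PS_mult (PS_incr_1 (PS_incr_1 a_coef)) d_coef n).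
  { unfold PS_mult. rewrite !scal_sum, <- !plus_sum. apply sum_eq. intros i _.
    replace (d_coef i * d_coef (n - i) * conj_c0) with (conj_c0 * d_coef i * d_coef (n - i)) by ring.
    rewrite d_eq_a. ring. }
  rewrite E, !PS_mult_incr_1.
  destruct n as [|[|[|n]]]; simpl PS_incr_1; rewrite ?PS_mult_incr_1; simpl PS_incr_1;
    rewrite ?a_mult_d; unfold zero; simpl; ring.
Qed.

Lemma conj_c0_neg : conj_c0 < 0.
Proof.
  unfold conj_c0, conj0, nbr. simpl (0 =? 0)%Z. cbv iota.
  change (0 - 1)%Z with (-1)%Z. rewrite p0_00, (p0_neg (-1)) by lia.
  assert (H1 := p_hit_le1 (0 + 1) 0 0). assert (H2 := p_hit_le1 0 (0 + 1) 0).
  assert (H3 := p_hit_le1 0 (-1) 0). unfold p0. lra.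
Qed.

Lemma conj_c1_eq : conj_c1 = - 2 * conj_c0 * q_coef 0.
Proof.
  unfold conj_c1. change (-1)%Z with (- Z.of_nat 1)%Z. rewrite conj0_reversal.
  change (p0 1 0) with (q_coef 0). ring.
Qed.

(** Conjugation a second time: taking Laplacians on the axis in the reflection identity turns
    translates of [p0] into translates of [conj0]. By [conj0_laplacian] the left side is a local
    combination of [p0], so evaluation at $x=0$ and $x=-1$, where most terms vanish, yields
    relations between the constants. *)
Lemma conj0_laplacian_reflection (x : Z) :
  nbr conj0 (-2 - x) 0 - 4 * conj0 (-2 - x) 0
  = conj_c0 * conj0 (x + 2) 0 + conj_c1 * conj0 (x + 1) 0 + conj_c2 * conj0 x 0.
Proof.
  unfold nbr.
  replace (-2 - x + 1)%Z with (-2 - (x - 1))%Z by lia.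
  replace (-2 - x - 1)%Z with (-2 - (x + 1))%Z by lia.
  rewrite !conj0_reflection. unfold conj0. simpl (0 =? 0)%Z. cbv iota. unfold nbr.
  replace (x - 1 + 2)%Z with (x + 2 - 1)%Z by lia.
  replace (x - 1 + 1)%Z with (x + 1 - 1)%Z by lia.
  replace (x + 1 + 2)%Z with (x + 2 + 1)%Z by lia. ring.
Qed.

Lemma conj_c2_eq : conj_c2 * conj_c0 = 1.
Proof.
  assert (E := conj0_laplacian_reflection 0). change (-2 - 0)%Z with (-2)%Z in E.
  rewrite conj0_laplacian, !(conj0_axis_pos _) in E by lia.
  change (-2 + 2)%Z with 0%Z in E. rewrite p0_00, !p0_neg in E by lia.
  fold conj_c0 in E. lra.
Qed.

Lemma q0_eq : q_coef 0 * (1 + conj_c0 ^ 2) = 4.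
Proof.
  assert (E := conj0_laplacian_reflection (-1)). change (-2 - -1)%Z with (-1)%Z in E.
  rewrite conj0_laplacian in E.
  change (-1 + 2)%Z with 1%Z in E. change (-1 + 1)%Z with 0%Z in E.
  rewrite p0_00, (conj0_axis_pos 1), (p0_neg (-1)), (p0_neg (-1 - 2)), (p0_neg (-1 - 1)) in E by lia.
  change (p0 1 0) with (q_coef 0) in E. fold conj_c0 in E.
  replace (conj0 (-1) 0) with (- conj_c0 * q_coef 0) in E.
  2: { symmetry. apply (conj0_reversal 0). }
  rewrite conj_c1_eq in E. assert (E2 := conj_c2_eq).
  replace (conj_c2 * (- conj_c0 * q_coef 0)) with (- (conj_c2 * conj_c0) * q_coef 0) in E by ring.
  rewrite E2 in E. nra.
Qed.

Lemma is_series_fin3 (A B C : R) :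
  is_series (fun n => match n with O => A | 1%nat => B | 2%nat => C | _ => 0 end) (A + B + C).
Proof.
  set (u := fun n : nat => match n with O => A | 1%nat => B | 2%nat => C | _ => 0 end).
  apply (is_lim_seq_ext_loc (fun _ => A + B + C) (sum_n u) (Finite (A + B + C)));
    [|apply is_lim_seq_const].
  exists 2%nat. intros n Hn. symmetry.
  induction Hn as [|n Hn IH].
  - rewrite !sum_n_S, sum_O. reflexivity.
  - rewrite sum_n_S, IH. unfold u. destruct n as [|[|n]]; [lia|lia|]. ring.
Qed.

Lemma is_series_q_coef : is_series q_coef 1.
Proof.
  assert (H := Series_correct _ (ex_series_p_hit 1 0)). rewrite Series_p_hit in H. exact H.
Qed.

Lemma is_series_d_coef : is_series d_coef 0.
Proof.
  apply is_series_decr_1.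
  refine (eq_ind (opp 1) (is_series (fun k => d_coef (S k))) (is_series_opp q_coef 1 is_series_q_coef) _ _).
  symmetry. exact (plus_zero_l _).
Qed.

Lemma ex_series_Rabs_d : ex_series (fun k => Rabs (d_coef k)).
Proof.
  apply ex_series_incr_1. apply (ex_series_ext q_coef).
  - intros k. simpl. rewrite Rabs_Ropp, Rabs_pos_eq; [reflexivity|apply p_hit_ge0].
  - exists 1. apply is_series_q_coef.
Qed.

Definition alpha : R := (sqrt 2 - 1) ^ 2.

Lemma sqrt2_sqr : sqrt 2 * sqrt 2 = 2.
Proof. apply sqrt_sqrt. lra. Qed.

Lemma sqrt2_bounds : 1.4 < sqrt 2 < 1.5.
Proof.
  assert (H := sqrt2_sqr). assert (H0 := sqrt_pos 2). split; nra.
Qed.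

Lemma alpha_eq : alpha = 3 - 2 * sqrt 2.
Proof. unfold alpha. assert (H := sqrt2_sqr). simpl. lra. Qed.

Lemma alpha_bounds : 0 < alpha < 1 / 4.
Proof. rewrite alpha_eq. assert (H := sqrt2_bounds). assert (H1 := sqrt2_sqr). nra. Qed.

(* The relation D(1)^2 = 0 and q0_eq leave two reciprocal candidates for conj_c0 ^ 2. *)
Lemma conj_consts : conj_c0 = - (1 + sqrt 2) /\ q_coef 0 = (1 + alpha) / 2.
Proof.
  assert (E : conj_c0 + conj_c1 + conj_c2 = 0).
  { assert (H := is_series_mult _ _ _ _ is_series_d_coef is_series_d_coef ex_series_Rabs_d ex_series_Rabs_d).
    apply (is_series_scal_l conj_c0) in H.
    assert (H' := is_series_fin3 conj_c0 conj_c1 conj_c2).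
    apply is_series_unique in H. apply is_series_unique in H'.
    assert (H2 := Series_ext _ _ d_mult_d_c).
    refine (eq_trans (eq_trans (eq_sym H') (eq_trans (eq_sym H2) H)) _).
    change (conj_c0 * (0 * 0) = 0). ring. }
  assert (E2 := conj_c2_eq). assert (E3 := q0_eq). rewrite conj_c1_eq in E.
  assert (Hn := conj_c0_neg). assert (Hq := p_hit_le1 1 0 0). fold (q_coef 0) in Hq.
  set (k := conj_c0) in *. set (x := q_coef 0) in *.
  assert (E4 : k ^ 2 * (1 - 2 * x) + 1 = 0) by nra.
  assert (E5 : (k ^ 2) ^ 2 - 6 * k ^ 2 + 1 = 0) by nra.
  (* From [E4] and [q_coef 0 <= 1]. This rejects the candidate $3-2\sqrt2<1$; the sign of [k] itself
     comes from [conj_c0_neg]. *)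
  assert (Hk2 : 1 <= k ^ 2) by nra.
  assert (Hs := sqrt2_sqr). assert (Hb := sqrt2_bounds).
  assert (E6 : k ^ 2 = 3 + 2 * sqrt 2).
  { assert (F : (k ^ 2 - (3 + 2 * sqrt 2)) * (k ^ 2 - (3 - 2 * sqrt 2)) = 0) by nra.
    apply Rmult_integral in F. destruct F; lra. }
  split.
  - assert (F : (k - (1 + sqrt 2)) * (k + (1 + sqrt 2)) = 0) by nra.
    apply Rmult_integral in F. destruct F; lra.
  - rewrite alpha_eq. rewrite E6 in E4.
    apply (Rmult_eq_reg_l (3 + 2 * sqrt 2)); nra.
Qed.

Theorem d_mult_d (n : nat) :
  PS_mult d_coef d_coef n = match n with O => 1 | 1%nat => - (1 + alpha) | 2%nat => alpha | _ => 0 end.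
Proof.
  assert (Hn := conj_c0_neg). apply (Rmult_eq_reg_l conj_c0); [|lra].
  rewrite d_mult_d_c. destruct conj_consts as [E1 E2].
  assert (E3 := conj_c2_eq). assert (E4 := conj_c1_eq).
  destruct n as [|[|[|n]]]; [ring| | |ring].
  - rewrite E4, E2. field.
  - apply (Rmult_eq_reg_r conj_c0); [|lra]. rewrite E3, E1, alpha_eq.
    assert (Hs := sqrt2_sqr). nra.
Qed.

(** * The generating function on the closed unit disk *)

Lemma fst_sum_n_C (u : nat -> C) (n : nat) :
  fst (sum_n u n : C) = sum_n (fun k => fst (u k)) n.
Proof.
  induction n as [|n IH]; [rewrite !sum_O; reflexivity|].
  rewrite !sum_Sn. rewrite <- IH. reflexivity.
Qed.

Lemma snd_sum_n_C (u : nat -> C) (n : nat) :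
  snd (sum_n u n : C) = sum_n (fun k => snd (u k)) n.
Proof.
  induction n as [|n IH]; [rewrite !sum_O; reflexivity|].
  rewrite !sum_Sn. rewrite <- IH. reflexivity.
Qed.

Lemma is_series_C (u : nat -> C) (x y : R) :
  is_series (fun n => fst (u n)) x -> is_series (fun n => snd (u n)) y ->
  is_series u ((x, y) : C).
Proof.
  intros Hx Hy. unfold is_series.
  apply (filterlim_locally (U := C_UniformSpace)). intros eps.
  assert (Hx' := proj1 (filterlim_locally _ _) Hx eps).
  assert (Hy' := proj1 (filterlim_locally _ _) Hy eps).
  generalize (filter_and _ _ Hx' Hy'). apply filter_imp.
  intros n [H1 H2]. split.
  - rewrite fst_sum_n_C. exact H1.
  - rewrite snd_sum_n_C. exact H2.
Qed.

Lemma Csqrt_sqr (c : C) : 0 < fst c -> Csqrt (c * c)%C = c.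
Proof.
  destruct c as [x y]; simpl fst. intros Hx. unfold Csqrt.
  rewrite Cmod_mult.
  assert (E : Cmod (x, y) * Cmod (x, y) = x * x + y * y).
  { assert (H := Cmod2_alt (x, y)). simpl in H. lra. }
  rewrite E. simpl fst. simpl snd.
  replace ((x * x + y * y + (x * x - y * y)) / 2) with (x * x) by field.
  replace ((x * x + y * y - (x * x - y * y)) / 2) with (y * y) by field.
  rewrite sqrt_square by lra.
  destruct (Rlt_dec (x * y + y * x) 0) as [H|H].
  - replace (y * y) with ((- y) * (- y)) by ring. rewrite sqrt_square by nra. f_equal. ring.
  - rewrite sqrt_square by nra. reflexivity.
Qed.

Lemma Csqrt_0 : Csqrt 0 = RtoC 0.
Proof.
  unfold Csqrt. rewrite Cmod_0. simpl.
  replace ((0 + 0) / 2) with 0 by field. replace ((0 - 0) / 2) with 0 by field.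
  rewrite sqrt_0. destruct (Rlt_dec 0 0); [lra|reflexivity].
Qed.

Lemma Cpow_Cmod_le1 (z : C) (k : nat) : Cmod z <= 1 -> Cmod (z ^ k)%C <= 1.
Proof.
  intros H. rewrite Cmod_pow. rewrite <- (pow1 k). apply pow_incr.
  split; [apply Cmod_ge_0|exact H].
Qed.

Lemma fst_Cpow_le1 (z : C) (k : nat) : Cmod z <= 1 -> Rabs (fst (z ^ k)%C) <= 1.
Proof.
  intros H. eapply Rle_trans; [apply Rmax_l|]. eapply Rle_trans; [apply Rmax_Cmod|].
  apply Cpow_Cmod_le1, H.
Qed.

Lemma snd_Cpow_le1 (z : C) (k : nat) : Cmod z <= 1 -> Rabs (snd (z ^ k)%C) <= 1.
Proof.
  intros H. eapply Rle_trans; [apply Rmax_r|]. eapply Rle_trans; [apply Rmax_Cmod|].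
  apply Cpow_Cmod_le1, H.
Qed.

Lemma ex_series_Rabs_mult_le1 (u v : nat -> R) :
  ex_series (fun n => Rabs (u n)) -> (forall n, Rabs (v n) <= 1) ->
  ex_series (fun n => Rabs (u n * v n)).
Proof.
  intros Hu Hv. apply (ex_series_le (V := R_CompleteNormedModule) _ (fun n => Rabs (u n))); [|exact Hu].
  intros n. unfold norm; simpl. unfold abs; simpl. rewrite Rabs_Rabsolu, Rabs_mult.
  rewrite <- (Rmult_1_r (Rabs (u n))) at 2.
  apply Rmult_le_compat_l; [apply Rabs_pos|apply Hv].
Qed.

(** Kept as two real series, so that absolute convergence and Cauchy products concern real sequences
    only. *)
Definition Dgen (z : C) : C :=
  (Series (fun k => d_coef k * fst (z ^ k)%C), Series (fun k => d_coef k * snd (z ^ k)%C)).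

Definition Dre (z : C) (k : nat) : R := d_coef k * fst (z ^ k)%C.
Definition Dim (z : C) (k : nat) : R := d_coef k * snd (z ^ k)%C.

Lemma ex_series_Rabs_Dre (z : C) : Cmod z <= 1 -> ex_series (fun k => Rabs ((Dre z) k)).
Proof.
  intros Hz. apply (ex_series_Rabs_mult_le1 d_coef); [apply ex_series_Rabs_d|].
  intros n. apply fst_Cpow_le1, Hz.
Qed.

Lemma ex_series_Rabs_Dim (z : C) : Cmod z <= 1 -> ex_series (fun k => Rabs ((Dim z) k)).
Proof.
  intros Hz. apply (ex_series_Rabs_mult_le1 d_coef); [apply ex_series_Rabs_d|].
  intros n. apply snd_Cpow_le1, Hz.
Qed.

Lemma is_series_Dre (z : C) : Cmod z <= 1 -> is_series (Dre z) (fst (Dgen z)).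
Proof. intros Hz. apply Series_correct, ex_series_Rabs, (ex_series_Rabs_Dre z Hz). Qed.

Lemma is_series_Dim (z : C) : Cmod z <= 1 -> is_series (Dim z) (snd (Dgen z)).
Proof. intros Hz. apply Series_correct, ex_series_Rabs, (ex_series_Rabs_Dim z Hz). Qed.

Lemma is_series_Dgen (z : C) : Cmod z <= 1 -> is_series (fun k => (d_coef k * z ^ k)%C) (Dgen z).
Proof.
  intros Hz. rewrite (surjective_pairing (Dgen z)). apply is_series_C.
  - apply (is_series_ext (Dre z)); [|apply (is_series_Dre z Hz)]. intros n. unfold Dre. simpl. ring.
  - apply (is_series_ext (Dim z)); [|apply (is_series_Dim z Hz)]. intros n. unfold Dim. simpl. ring.
Qed.

(** Absolute summability of [d_coef] makes the Cauchy products legitimate up to the unit circle. The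
    four products of real and imaginary parts recombine through $z^n=z^kz^{n-k}$ into the
    coefficients of [d_mult_d]. *)
Lemma Dgen_sqr (z : C) : Cmod z <= 1 -> (Dgen z * Dgen z)%C = ((1 - z) * (1 - z * alpha))%C.
Proof.
  intros Hz. assert (Huu := is_series_mult _ _ _ _ (is_series_Dre z Hz) (is_series_Dre z Hz) (ex_series_Rabs_Dre z Hz) (ex_series_Rabs_Dre z Hz)).
  assert (Hvv := is_series_mult _ _ _ _ (is_series_Dim z Hz) (is_series_Dim z Hz) (ex_series_Rabs_Dim z Hz) (ex_series_Rabs_Dim z Hz)).
  assert (Huv := is_series_mult _ _ _ _ (is_series_Dre z Hz) (is_series_Dim z Hz) (ex_series_Rabs_Dre z Hz) (ex_series_Rabs_Dim z Hz)).
  assert (Hvu := is_series_mult _ _ _ _ (is_series_Dim z Hz) (is_series_Dre z Hz) (ex_series_Rabs_Dim z Hz) (ex_series_Rabs_Dre z Hz)).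
  assert (Hre := is_series_minus _ _ _ _ Huu Hvv).
  assert (Him := is_series_plus _ _ _ _ Huv Hvu).
  assert (Hzz : forall n k, (k <= n)%nat -> (z ^ n)%C = (z ^ k * z ^ (n - k))%C).
  { intros n k Hk. rewrite <- Cpow_add_r. f_equal. lia. }
  assert (Ere : Series (fun n => PS_mult d_coef d_coef n * fst (z ^ n)%C) = fst (Dgen z * Dgen z)%C).
  { apply is_series_unique. refine (is_series_ext _ _ _ _ Hre).
    intros n. unfold PS_mult. rewrite Rmult_comm, scal_sum.
    match goal with |- plus ?x (opp ?y) = ?r => change (x - y = r) end.
    rewrite <- minus_sum. apply sum_eq. intros k Hk. unfold Dre, Dim. rewrite (Hzz n k Hk). simpl. ring. }
  assert (Eim : Series (fun n => PS_mult d_coef d_coef n * snd (z ^ n)%C) = snd (Dgen z * Dgen z)%C).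
  { apply is_series_unique. refine (is_series_ext _ _ _ _ Him).
    intros n. unfold PS_mult. rewrite Rmult_comm, scal_sum.
    match goal with |- plus ?x ?y = ?r => change (x + y = r) end.
    rewrite <- plus_sum. apply sum_eq. intros k Hk. unfold Dre, Dim. rewrite (Hzz n k Hk). simpl. ring. }
  rewrite (surjective_pairing (Dgen z * Dgen z)%C), <- Ere, <- Eim.
  assert (E3 : forall c : nat -> R, Series (fun n => PS_mult d_coef d_coef n * c n)
            = c 0%nat - (1 + alpha) * c 1%nat + alpha * c 2%nat).
  { intros c. apply is_series_unique.
    replace (c 0%nat - (1 + alpha) * c 1%nat + alpha * c 2%nat)
      with (c 0%nat + - (1 + alpha) * c 1%nat + alpha * c 2%nat) by ring.
    refine (is_series_ext _ _ _ _ (is_series_fin3 (c 0%nat) (- (1 + alpha) * c 1%nat) (alpha * c 2%nat))).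
    intros n. rewrite d_mult_d.
    destruct n as [|[|[|n]]]; match goal with |- ?x = ?y => change (@eq R x y) end; ring. }
  rewrite (E3 (fun n => fst (z ^ n)%C)), (E3 (fun n => snd (z ^ n)%C)).
  destruct z as [x y]. simpl. apply injective_projections; simpl; ring.
Qed.

(** Since $\sum_k q_k=1$, the real part of $D$ is $\sum_k q_k(1-\mathrm{Re}\,z^{k+1})$, a sum of
    nonnegative terms of which the first is kept. It serves to select the branch of the square
    root. *)
Lemma Dgen_re (z : C) : Cmod z <= 1 -> q_coef 0 * (1 - fst z) <= fst (Dgen z).
Proof.
  intros Hz. assert (H := is_series_unique _ _ (is_series_Dre z Hz)). rewrite <- H.
  assert (E : Series (Dre z) = Series (fun k => q_coef k * (1 - fst (z ^ S k)%C))).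
  { rewrite Series_incr_1 by (apply ex_series_Rabs, (ex_series_Rabs_Dre z Hz)).
    assert (Hex : ex_series (fun k => q_coef k * fst (z ^ S k)%C)).
    { apply ex_series_Rabs, ex_series_Rabs_mult_le1.
      - apply (ex_series_ext q_coef); [|exists 1; apply is_series_q_coef].
        intros n. rewrite Rabs_pos_eq; [reflexivity|apply p_hit_ge0].
      - intros n. apply fst_Cpow_le1, Hz. }
    rewrite (Series_ext (fun k => q_coef k * (1 - fst (z ^ S k)%C)) (fun k => q_coef k - q_coef k * fst (z ^ S k)%C))
      by (intros; ring).
    rewrite Series_minus; [|exists 1; apply is_series_q_coef|exact Hex].
    rewrite (is_series_unique _ _ is_series_q_coef).
    rewrite (Series_ext (fun k => (Dre z) (S k)) (fun k => - (q_coef k * fst (z ^ S k)%C))).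
    - rewrite Series_opp. unfold Dre. simpl. ring.
    - intros n. unfold Dre. simpl. ring. }
  rewrite E.
  assert (Hex : ex_series (fun k => q_coef k * (1 - fst (z ^ S k)%C))).
  { apply (ex_series_le (V := R_CompleteNormedModule) _ (fun k => 2 * q_coef k)).
    - intros n. unfold norm; simpl. unfold abs; simpl.
      assert (Hq : 0 <= q_coef n) by apply p_hit_ge0.
      rewrite Rabs_mult, (Rabs_pos_eq (q_coef n)) by exact Hq. rewrite Rmult_comm.
      apply Rmult_le_compat_r; [exact Hq|].
      assert (H1 := fst_Cpow_le1 z (S n) Hz). apply Rabs_le. apply Rabs_le_between in H1.
      simpl in H1. lra.
    - apply (ex_series_scal_l 2 q_coef). exists 1. apply is_series_q_coef. }
  rewrite Series_incr_1 by exact Hex.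
  cut (0 <= Series (fun k => q_coef (S k) * (1 - fst (z ^ S (S k))%C))).
  { intros H1. simpl in *. lra. }
  apply (is_lim_seq_le (fun _ => 0) (sum_n (fun k => q_coef (S k) * (1 - fst (z ^ S (S k))%C))) 0
     (Series (fun k => q_coef (S k) * (1 - fst (z ^ S (S k))%C)))).
  - assert (Hp : forall k, 0 <= q_coef (S k) * (1 - fst (z ^ S (S k))%C)).
    { intros k. apply Rmult_le_pos; [apply p_hit_ge0|].
      assert (H1 := fst_Cpow_le1 z (S (S k)) Hz). apply Rabs_le_between in H1. lra. }
    intros n. induction n as [|n IH]; [rewrite sum_O; apply Hp|].
    rewrite sum_n_S. specialize (Hp (S n)). lra.
  - apply is_lim_seq_const.
  - apply (Series_correct (fun k => q_coef (S k) * (1 - fst (z ^ S (S k))%C))).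
    apply (ex_series_incr_1 (fun k => q_coef k * (1 - fst (z ^ S k)%C))). exact Hex.
Qed.

(* Both sides square to (1-z)(1-alpha z), and D has positive real part unless z = 1. *)
Theorem Dgen_eq (z : C) : Cmod z <= 1 -> Dgen z = sq_factor z.
Proof.
  intros Hz. assert (E := (Dgen_sqr z Hz)). unfold sq_factor. fold alpha. rewrite <- E.
  destruct (Rlt_dec (fst z) 1) as [H|H].
  - symmetry. apply Csqrt_sqr.
    assert (H1 := Dgen_re z Hz). destruct conj_consts as [_ H2]. assert (H3 := alpha_bounds).
    rewrite H2 in H1. nra.
  - assert (Ez : z = RtoC 1).
    { destruct z as [x y]. simpl in H. assert (Hm := Cmod2_alt (x, y)). simpl in Hm.
      assert (H0 := Cmod_ge_0 (x, y)).
      assert (x = 1) by nra. assert (y = 0) by nra. subst. reflexivity. }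
    assert (E0 : (Dgen z * Dgen z)%C = 0).
    { rewrite E, Ez. ring. }
    rewrite E0, Csqrt_0.
    destruct (Ceq_dec (Dgen z) 0) as [H0|H0]; [exact H0|].
    exfalso. exact (Cmult_neq_0 _ _ H0 H0 E0).
Qed.


(** * Coefficients in Q and Q(sqrt 2) *)

Definition inQ (r : R) : Prop := exists a : Q, r = Q2R a.
Definition inK (r : R) : Prop := exists a b : Q, r = Q2R a + Q2R b * sqrt 2.

Lemma inQ_Z (n : Z) : inQ (IZR n).
Proof. exists (inject_Z n). unfold Q2R, inject_Z. simpl. field. Qed.

Lemma inQ_plus (x y : R) : inQ x -> inQ y -> inQ (x + y).
Proof. intros [a ->] [b ->]. exists (a + b)%Q. symmetry; apply Q2R_plus. Qed.

Lemma inQ_mult (x y : R) : inQ x -> inQ y -> inQ (x * y).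
Proof. intros [a ->] [b ->]. exists (a * b)%Q. symmetry; apply Q2R_mult. Qed.

Lemma inQ_half : inQ (/ 2).
Proof. exists (1 # 2)%Q. unfold Q2R. simpl. lra. Qed.

Lemma inQ_inK (x : R) : inQ x -> inK x.
Proof. intros [a ->]. exists a, 0%Q. unfold Q2R at 3. simpl. ring. Qed.

Lemma inK_Z (n : Z) : inK (IZR n).
Proof. apply inQ_inK, inQ_Z. Qed.

Lemma inK_plus (x y : R) : inK x -> inK y -> inK (x + y).
Proof.
  intros [a [b ->]] [c [e ->]]. exists (a + c)%Q, (b + e)%Q. rewrite !Q2R_plus. ring.
Qed.

Lemma inK_mult (x y : R) : inK x -> inK y -> inK (x * y).
Proof.
  intros [a [b ->]] [c [e ->]]. exists (a * c + (2 # 1) * (b * e))%Q, (a * e + b * c)%Q.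
  rewrite !Q2R_plus, !Q2R_mult. replace (Q2R (2 # 1)) with 2 by (unfold Q2R; simpl; field).
  assert (H := sqrt2_sqr). ring [H].
Qed.

Lemma inK_opp (x : R) : inK x -> inK (- x).
Proof.
  intros H. replace (- x) with (-1 * x) by ring. apply inK_mult; [apply inK_Z|exact H].
Qed.

Lemma inK_minus (x y : R) : inK x -> inK y -> inK (x - y).
Proof. intros Hx Hy. apply inK_plus; [exact Hx|apply inK_opp, Hy]. Qed.

Lemma inK_half (x : R) : inK x -> inK (x / 2).
Proof. intros H. apply inK_mult; [exact H|apply inQ_inK, inQ_half]. Qed.

Lemma inK_sqrt2 : inK (sqrt 2).
Proof. exists 0%Q, 1%Q. unfold Q2R. simpl. field. Qed.

Lemma inK_sum (u : nat -> R) (n : nat) :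
  (forall k, (k <= n)%nat -> inK (u k)) -> inK (sum_f_R0 u n).
Proof.
  induction n as [|n IH]; intros H; simpl.
  - apply H. lia.
  - apply inK_plus; [apply IH; intros; apply H; lia|apply H; lia].
Qed.

Lemma inK_alpha : inK alpha.
Proof.
  rewrite alpha_eq. apply inK_minus; [apply inK_Z|].
  apply inK_mult; [apply inK_Z|apply inK_sqrt2].
Qed.

(** For $n\ge1$ the coefficient of $z^n$ in $D^2$ is $2d_n$ plus products of earlier coefficients,
    so [d_mult_d] yields $d_n$ by ring operations and halving. *)
Lemma inK_d_coef (n : nat) : inK (d_coef n).
Proof.
  induction n as [n IH] using (well_founded_induction lt_wf).
  assert (Hc : inK (PS_mult d_coef d_coef n)).
  { rewrite d_mult_d. assert (H := inK_alpha).
    destruct n as [|[|[|n]]]; try exact H; try apply inK_Z.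
    apply inK_opp, inK_plus; [apply inK_Z|exact H]. }
  destruct n as [|[|m]].
  - simpl. apply inK_Z.
  - replace (d_coef 1) with (PS_mult d_coef d_coef 1 / 2) by (unfold PS_mult; simpl; field).
    apply inK_half, Hc.
  - assert (E : PS_mult d_coef d_coef (S (S m)) = 2 * d_coef (S (S m))
              + sum_f_R0 (fun k => d_coef (S k) * d_coef (S m - k)%nat) m).
    { unfold PS_mult. rewrite decomp_sum by lia. simpl pred.
      rewrite tech5. rewrite (sum_eq _ (fun k => d_coef (S k) * d_coef (S m - k)%nat)) by reflexivity.
      replace (S (S m) - S (S m))%nat with 0%nat by lia.
      replace (S (S m) - 0)%nat with (S (S m)) by lia. simpl (d_coef 0). ring. }
    replace (d_coef (S (S m))) with
      ((PS_mult d_coef d_coef (S (S m)) - sum_f_R0 (fun k => d_coef (S k) * d_coef (S m - k)%nat) m) / 2)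
      by (rewrite E; field).
    apply inK_half, inK_minus; [exact Hc|]. apply inK_sum. intros k Hk.
    apply inK_mult; apply IH; lia.
Qed.

Lemma inK_q_coef (n : nat) : inK (q_coef n).
Proof. replace (q_coef n) with (- d_coef (S n)) by (simpl; ring). apply inK_opp, inK_d_coef. Qed.

Lemma inK_p_hit_axis (x : Z) (k : nat) : inK (p_hit x 0 k).
Proof.
  assert (Hneg : forall x k, (x <= 0)%Z -> inK (p_hit x 0 k)).
  { intros y j H. rewrite p_hit_slit by exact H. destruct (_ =? _)%Z; apply inK_Z. }
  assert (Hpos : forall n k, inK (p_hit (Z.of_nat n) 0 k)).
  { induction n as [|n IH]; intros j; [apply Hneg; lia|].
    replace (Z.of_nat (S n)) with (Z.of_nat n + 1)%Z by lia. rewrite p_hit_shift.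
    apply inK_plus; [apply IH|]. apply inK_mult; [apply IH|apply inK_q_coef]. }
  destruct (Z_le_gt_dec x 0); [apply Hneg; lia|].
  rewrite <- (Z2Nat.id x) by lia. apply Hpos.
Qed.

Lemma inK_conj0_axis (x : Z) : inK (conj0 x 0).
Proof.
  assert (Hc : inK conj_c0).
  { rewrite (proj1 conj_consts). apply inK_opp, inK_plus; [apply inK_Z|apply inK_sqrt2]. }
  destruct (Z_lt_ge_dec 0 x); [rewrite conj0_axis_pos by lia; apply inK_Z|].
  destruct (Z.eq_dec x 0) as [-> |]; [exact Hc|].
  replace x with (- Z.of_nat (S (Z.to_nat (- x - 1))))%Z by lia.
  rewrite conj0_reversal. apply inK_mult; [apply inK_opp, Hc|apply inK_q_coef].
Qed.

(** These are the scalars that enter $g$ when the starting point moves along a row. Harmonicity does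
    not give row 1 above the slit; [conj0_axis] does, the axis values of [conj0] being known by time
    reversal. Harmonicity then gives the higher rows. *)
Lemma inK_p0 (x y : Z) : inK (p0 x y).
Proof.
  assert (H0 : forall x, inK (p0 x 0)) by (intros; apply inK_p_hit_axis).
  assert (H1 : forall x, inK (p0 x 1)).
  { clear x. intros x.
    replace (p0 x 1) with ((conj0 x 0 - p0 (x + 1) 0 - p0 (x - 1) 0 + 4 * p0 x 0) / 2)
      by (rewrite conj0_axis; field).
    apply inK_half. apply inK_plus; [|apply inK_mult; [apply inK_Z|apply H0]].
    repeat (apply inK_minus; [|apply H0]). apply inK_conj0_axis. }
  assert (Hn : forall n x, inK (p0 x (Z.of_nat n)) /\ inK (p0 x (Z.of_nat (S n)))).
  { induction n as [|n IH]; intros a; [split; [apply H0|apply H1]|].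
    split; [apply IH|].
    assert (E := p0_harmonic a (Z.of_nat (S n)) ltac:(apply inH_false_iff; lia)).
    unfold harmonic_at in E.
    replace (Z.of_nat (S n) + 1)%Z with (Z.of_nat (S (S n))) in E by lia.
    replace (Z.of_nat (S n) - 1)%Z with (Z.of_nat n) in E by lia.
    replace (p0 a (Z.of_nat (S (S n)))) with (4 * p0 a (Z.of_nat (S n)) - p0 (a + 1) (Z.of_nat (S n))
      - p0 (a - 1) (Z.of_nat (S n)) - p0 a (Z.of_nat n)) by lra.
    repeat (apply inK_minus; [|apply IH]). apply inK_mult; [apply inK_Z|apply IH]. }
  rewrite <- p0_abs, <- (Z2Nat.id (Z.abs y)) by lia. apply Hn.
Qed.

(** * Laurent polynomials over a ring of real coefficients *)

Lemma Cpowz_nat (z : C) (n : nat) : Cpowz z (Z.of_nat n) = (z ^ n)%C.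
Proof.
  destruct n as [|n]; [reflexivity|].
  change (z ^ Pos.to_nat (Pos.of_succ_nat n) = z ^ S n)%C.
  rewrite SuccNat2Pos.id_succ. reflexivity.
Qed.

Lemma Cpowz_opp_nat (z : C) (n : nat) : Cpowz z (- Z.of_nat n) = (/ z ^ n)%C.
Proof.
  destruct n as [|n].
  - simpl. field.
  - change (/ z ^ Pos.to_nat (Pos.of_succ_nat n) = / z ^ S n)%C. rewrite SuccNat2Pos.id_succ. reflexivity.
Qed.

Lemma Cpowz_succ (z : C) (m : Z) : z <> 0 -> Cpowz z (m + 1) = (z * Cpowz z m)%C.
Proof.
  intros Hz. destruct (Z_le_gt_dec 0 m) as [H|H].
  - rewrite <- (Z2Nat.id m) by lia. replace (Z.of_nat (Z.to_nat m) + 1)%Z with (Z.of_nat (S (Z.to_nat m))) by lia.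
    rewrite !Cpowz_nat. reflexivity.
  - replace m with (- Z.of_nat (S (Z.to_nat (- m - 1))))%Z by lia.
    set (n := Z.to_nat (- m - 1)).
    replace (- Z.of_nat (S n) + 1)%Z with (- Z.of_nat n)%Z by lia.
    rewrite !Cpowz_opp_nat, Cpow_S. field. split; [apply Cpow_nz|]; exact Hz.
Qed.

Fixpoint laurentR (m : Z) (cs : list R) (z : C) : C :=
  match cs with
  | nil => RtoC 0
  | c :: cs' => (c * Cpowz z m + laurentR (m + 1) cs' z)%C
  end.

(** Semantic rather than syntactic, so closure properties are stated on functions; the point 0 is
    left out because negative powers have no meaning there. *)
Definition isLaurent (P : R -> Prop) (f : C -> C) : Prop :=
  exists m cs, List.Forall P cs /\ forall z : C, z <> 0 -> f z = laurentR m cs z.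

Definition coef_ring (P : R -> Prop) : Prop :=
  (forall n : Z, P (IZR n)) /\ (forall x y, P x -> P y -> P (x + y)) /\
  (forall x y, P x -> P y -> P (x * y)).

Lemma coef_ring_Q : coef_ring inQ.
Proof. repeat split; [apply inQ_Z|apply inQ_plus|apply inQ_mult]. Qed.

Lemma coef_ring_K : coef_ring inK.
Proof. repeat split; [apply inK_Z|apply inK_plus|apply inK_mult]. Qed.

Lemma laurentR_succ (m : Z) (cs : list R) (z : C) : z <> 0 ->
  laurentR (m + 1) cs z = (z * laurentR m cs z)%C.
Proof.
  intros Hz. revert m; induction cs as [|c cs IH]; intros m; simpl; [ring|].
  rewrite IH, Cpowz_succ by exact Hz. ring.
Qed.

Lemma laurentR_pad (n : nat) (m : Z) (cs : list R) (z : C) :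
  laurentR (m - Z.of_nat n) (repeat 0 n ++ cs) z = laurentR m cs z.
Proof.
  revert m; induction n as [|n IH]; intros m; cbn [repeat app laurentR].
  - f_equal. lia.
  - replace (m - Z.of_nat (S n) + 1)%Z with (m - Z.of_nat n)%Z by lia. rewrite IH. ring.
Qed.

Fixpoint addl (cs ds : list R) : list R :=
  match cs, ds with
  | nil, _ => ds
  | _, nil => cs
  | c :: cs', e :: ds' => (c + e) :: addl cs' ds'
  end.

Lemma laurentR_addl (m : Z) (cs ds : list R) (z : C) :
  laurentR m (addl cs ds) z = (laurentR m cs z + laurentR m ds z)%C.
Proof.
  revert m ds; induction cs as [|c cs IH]; intros m [|e ds]; simpl; try ring.
  rewrite IH, RtoC_plus. ring.
Qed.

Lemma Forall_addl (P : R -> Prop) (cs ds : list R) : coef_ring P ->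
  List.Forall P cs -> List.Forall P ds -> List.Forall P (addl cs ds).
Proof.
  intros [_ [HP _]] Hc. revert ds; induction Hc as [|c cs H0 Hc IH]; intros ds Hd; [exact Hd|].
  destruct Hd as [|e ds H1 Hd]; simpl; [constructor; assumption|].
  constructor; [apply HP; assumption|apply IH, Hd].
Qed.

Lemma isLaurent_plus (P : R -> Prop) (f g : C -> C) : coef_ring P ->
  isLaurent P f -> isLaurent P g -> isLaurent P (fun z => (f z + g z)%C).
Proof.
  intros HP [m [cs [Hc Ef]]] [m' [ds [Hd Eg]]].
  pose (l := Z.min m m').
  exists l, (addl (repeat 0 (Z.to_nat (m - l)) ++ cs) (repeat 0 (Z.to_nat (m' - l)) ++ ds)).
  assert (H0 : forall n, List.Forall P (repeat 0 n)).
  { intros n. apply Forall_forall. intros x Hx. apply repeat_spec in Hx. subst x. apply HP. }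
  split.
  - apply Forall_addl; [exact HP| |]; apply Forall_app; split; auto.
  - intros z Hz. rewrite laurentR_addl, Ef, Eg by exact Hz. f_equal.
    + rewrite <- (laurentR_pad (Z.to_nat (m - l)) m). f_equal. lia.
    + rewrite <- (laurentR_pad (Z.to_nat (m' - l)) m'). f_equal. lia.
Qed.

Lemma isLaurent_scal (P : R -> Prop) (f : C -> C) (r : R) : coef_ring P -> P r ->
  isLaurent P f -> isLaurent P (fun z => (r * f z)%C).
Proof.
  intros HP Hr [m [cs [Hc Ef]]]. exists m, (map (Rmult r) cs). split.
  - apply Forall_map. eapply Forall_impl; [|exact Hc]. intros x Hx. apply HP; assumption.
  - intros z Hz. rewrite Ef by exact Hz. clear. revert m; induction cs as [|c cs IH]; intros m; simpl.
    + ring.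
    + rewrite <- IH, RtoC_mult. ring.
Qed.

Lemma isLaurent_mulz (P : R -> Prop) (f : C -> C) :
  isLaurent P f -> isLaurent P (fun z => (z * f z)%C).
Proof.
  intros [m [cs [Hc Ef]]]. exists (m + 1)%Z, cs. split; [exact Hc|].
  intros z Hz. rewrite laurentR_succ, Ef by exact Hz. reflexivity.
Qed.

Lemma isLaurent_divz (P : R -> Prop) (f : C -> C) :
  isLaurent P f -> isLaurent P (fun z => (f z / z)%C).
Proof.
  intros [m [cs [Hc Ef]]]. exists (m - 1)%Z, cs. split; [exact Hc|].
  intros z Hz. rewrite Ef by exact Hz. replace m with (m - 1 + 1)%Z at 1 by lia.
  rewrite laurentR_succ by exact Hz. field. exact Hz.
Qed.

Lemma isLaurent_const (P : R -> Prop) (r : R) : P r -> isLaurent P (fun _ => RtoC r).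
Proof.
  intros HP. exists 0%Z, (r :: nil). split.
  - constructor; [exact HP|constructor].
  - intros z _. simpl. ring.
Qed.

Lemma isLaurent_Q (f : C -> C) : isLaurent inQ f ->
  exists m cs, forall z : C, z <> 0 -> f z = laurentQ m cs z.
Proof.
  intros [m [cs [Hc Ef]]].
  assert (H : exists ds, forall m z, laurentR m cs z = laurentQ m ds z).
  { clear Ef. induction Hc as [|c cs [a ->] Hc [ds IH]]; [exists nil; reflexivity|].
    exists (a :: ds). intros m' z. simpl. rewrite IH. reflexivity. }
  destruct H as [ds H]. exists m, ds. intros z Hz. rewrite Ef by exact Hz. apply H.
Qed.

Lemma isLaurent_K (f : C -> C) : isLaurent inK f ->
  exists m cs, forall z : C, z <> 0 -> f z = laurentQs2 m cs z.
Proof.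
  intros [m [cs [Hc Ef]]].
  assert (H : exists ds, forall m z, laurentR m cs z = laurentQs2 m ds z).
  { clear Ef. induction Hc as [|c cs [a [b ->]] Hc [ds IH]]; [exists nil; reflexivity|].
    exists ((a, b) :: ds). intros m' z. simpl. rewrite IH. reflexivity. }
  destruct H as [ds H]. exists m, ds. intros z Hz. rewrite Ef by exact Hz. apply H.
Qed.

(** * Wallis' formula *)

Definition wallis (n : nat) : R := RInt (fun x => sin x ^ n) 0 (PI / 2).

Lemma ex_RInt_sin_pow (n : nat) (x y : R) : ex_RInt (fun t => sin t ^ n) x y.
Proof.
  apply (ex_RInt_continuous (V := R_CompleteNormedModule)). intros t _.
  apply (ex_derive_continuous (K := R_AbsRing) (V := R_NormedModule) (fun t => sin t ^ n)).
  auto_derive. exact I.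
Qed.

Lemma wallis_0 : wallis 0 = PI / 2.
Proof.
  unfold wallis. simpl. rewrite RInt_const.
  change ((PI / 2 - 0) * 1 = PI / 2). ring.
Qed.

Lemma wallis_1 : wallis 1 = 1.
Proof.
  unfold wallis.
  assert (H : is_RInt (fun x => sin x ^ 1) 0 (PI / 2) (minus (- cos (PI / 2)) (- cos 0))).
  { apply (is_RInt_derive (V := R_CompleteNormedModule) (fun x => - cos x)).
    - intros x _. auto_derive; [exact I|ring].
    - intros x _.
      apply (ex_derive_continuous (K := R_AbsRing) (V := R_NormedModule) (fun t => sin t ^ 1)).
      auto_derive. exact I. }
  apply (is_RInt_unique (V := R_CompleteNormedModule)) in H. refine (eq_trans H _).
  change (- cos (PI / 2) - - cos 0 = 1). rewrite cos_PI2, cos_0. ring.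
Qed.

(** The difference of the two sides is the integral of the derivative of $-\cos x\,\sin^{n+1}x$,
    which vanishes at both ends. *)
Lemma wallis_rec (n : nat) : INR (n + 2) * wallis (n + 2) = INR (n + 1) * wallis n.
Proof.
  pose (df := fun x => INR (n + 2) * sin x ^ (n + 2) - INR (n + 1) * sin x ^ n).
  assert (H : is_RInt df 0 (PI / 2) (minus (- cos (PI / 2) * sin (PI / 2) ^ (n + 1))
                                          (- cos 0 * sin 0 ^ (n + 1)))).
  { apply (is_RInt_derive (V := R_CompleteNormedModule) (fun x => - cos x * sin x ^ (n + 1))).
    - intros x _. unfold df. auto_derive; [exact I|].
      replace (Init.Nat.pred (n + 1)) with n by lia.
      rewrite !pow_add, !plus_INR. assert (E := sin2_cos2 x). unfold Rsqr in E.
      simpl (INR 1). simpl (INR 2).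
      assert (Ec : cos x * cos x = 1 - sin x * sin x) by lra. ring [Ec].
    - intros x _. unfold df.
      apply (ex_derive_continuous (K := R_AbsRing) (V := R_NormedModule)
         (fun x => INR (n + 2) * sin x ^ (n + 2) - INR (n + 1) * sin x ^ n)).
      auto_derive. split; exact I || (split; exact I). }
  apply (is_RInt_unique (V := R_CompleteNormedModule)) in H.
  assert (E : RInt df 0 (PI / 2) = INR (n + 2) * wallis (n + 2) - INR (n + 1) * wallis n).
  { unfold df, wallis.
    rewrite (RInt_minus (V := R_CompleteNormedModule)).
    - rewrite !(RInt_scal (V := R_CompleteNormedModule)) by apply ex_RInt_sin_pow. reflexivity.
    - apply (ex_RInt_scal (V := R_NormedModule)), ex_RInt_sin_pow.
    - apply (ex_RInt_scal (V := R_NormedModule)), ex_RInt_sin_pow. }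
  rewrite E in H.
  replace (minus (- cos (PI / 2) * sin (PI / 2) ^ (n + 1)) (- cos 0 * sin 0 ^ (n + 1))) with 0 in H.
  - lra.
  - rewrite cos_PI2, sin_0, (pow_ne_zero (n + 1)) by lia.
    match goal with |- _ = minus ?x ?y => change (0 = x - y) end. ring.
Qed.

Lemma wallis_decr (n : nat) : wallis (S n) <= wallis n.
Proof.
  assert (Hpi := PI_RGT_0).
  apply RInt_le; [lra|apply ex_RInt_sin_pow|apply ex_RInt_sin_pow|].
  intros x Hx. simpl.
  assert (H0 : 0 < sin x) by (apply sin_gt_0; lra).
  assert (H1 := SIN_bound x).
  rewrite <- (Rmult_1_l (sin x ^ n)) at 2. apply Rmult_le_compat_r; [|lra].
  apply pow_le; lra.
Qed.

(** By [wallis_rec] the left side does not depend on [n]; its value is read off at $n=0$. *)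
Lemma wallis_prod (n : nat) : INR (n + 1) * (wallis n * wallis (n + 1)) = PI / 2.
Proof.
  induction n as [|n IH].
  - simpl (0 + 1)%nat. rewrite wallis_0, wallis_1. simpl. ring.
  - replace (S n + 1)%nat with (n + 2)%nat by lia. rewrite <- IH.
    replace (INR (n + 2) * (wallis (S n) * wallis (n + 2)))
      with (INR (n + 2) * wallis (n + 2) * wallis (S n)) by ring.
    rewrite wallis_rec. replace (n + 1)%nat with (S n) by lia. ring.
Qed.

(* beta n = binom(2n, n) / 4^n *)
Fixpoint beta (n : nat) : R :=
  match n with
  | O => 1
  | S m => beta m * (INR (2 * m + 1) / INR (2 * m + 2))
  end.

Lemma beta_wallis (n : nat) : wallis (2 * n) = PI / 2 * beta n.
Proof.
  induction n as [|n IH]; cbn [beta].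
  - change (2 * 0)%nat with 0%nat. rewrite wallis_0. ring.
  - assert (E := wallis_rec (2 * n)). rewrite IH in E.
    replace (2 * S n)%nat with (2 * n + 2)%nat by lia.
    assert (H : INR (2 * n + 2) <> 0) by (apply not_0_INR; lia).
    apply (Rmult_eq_reg_l (INR (2 * n + 2))); [|exact H]. rewrite E. field. exact H.
Qed.

Lemma beta_pos (n : nat) : 0 < beta n.
Proof.
  induction n as [|n IH]; simpl; [lra|].
  apply Rmult_lt_0_compat; [exact IH|]. apply Rdiv_lt_0_compat; apply lt_0_INR; lia.
Qed.

(** Monotonicity gives $W_mW_{m+1}\le W_m^2\le W_{m-1}W_m$ at $m=2n+2$, and [wallis_prod] evaluates
    the outer products. *)
Lemma beta_bounds (n : nat) :
  2 / PI * ((INR n + 2) / (2 * INR n + 3)) <= (INR n + 2) * beta (S n) ^ 2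
     <= 1 / PI * ((INR n + 2) / (INR n + 1)).
Proof.
  assert (Hpi := PI_RGT_0).
  assert (Hb := beta_pos (S n)). assert (Hn := pos_INR n).
  assert (P1 := wallis_prod (2 * S n)). assert (P2 := wallis_prod (2 * n + 1)).
  assert (D1 := wallis_decr (2 * S n)). assert (D2 := wallis_decr (2 * n + 1)).
  replace (2 * n + 1 + 1)%nat with (2 * S n)%nat in * by lia.
  replace (S (2 * n + 1)) with (2 * S n)%nat in * by lia.
  replace (2 * S n + 1)%nat with (S (2 * S n))%nat in * by lia.
  assert (EB := beta_wallis (S n)).
  set (x := wallis (2 * S n)) in *.
  set (y := wallis (S (2 * S n))) in *. set (z := wallis (2 * n + 1)) in *.
  assert (Eb : beta (S n) = 2 / PI * x) by (rewrite EB; field; lra).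
  assert (Hx : 0 < x) by (rewrite EB; apply Rmult_lt_0_compat; lra).
  assert (I1 : INR (S (2 * S n)) = 2 * INR n + 3).
  { rewrite S_INR, mult_INR, (S_INR n). simpl (INR 2). ring. }
  assert (I2 : INR (2 * S n) = 2 * (INR n + 1)).
  { rewrite mult_INR, (S_INR n). simpl (INR 2). ring. }
  rewrite I1 in P1. rewrite I2 in P2.
  clearbody x y z.
  assert (X1 : PI / 2 / (2 * INR n + 3) <= x * x).
  { replace (PI / 2 / (2 * INR n + 3)) with (x * y) by (rewrite <- P1; field; lra).
    apply Rmult_le_compat_l; lra. }
  assert (X2 : x * x <= PI / 2 / (2 * (INR n + 1))).
  { replace (PI / 2 / (2 * (INR n + 1))) with (z * x) by (rewrite <- P2; field; lra).
    apply Rmult_le_compat_r; lra. }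
  rewrite Eb.
  replace ((INR n + 2) * (2 / PI * x) ^ 2) with ((INR n + 2) * (4 / PI ^ 2) * (x * x)) by (field; lra).
  assert (H4 : 0 < (INR n + 2) * (4 / PI ^ 2)).
  { apply Rmult_lt_0_compat; [lra|]. apply Rdiv_lt_0_compat; [lra|]. apply pow_lt; lra. }
  split.
  - replace (2 / PI * ((INR n + 2) / (2 * INR n + 3)))
      with ((INR n + 2) * (4 / PI ^ 2) * (PI / 2 / (2 * INR n + 3))) by (field; lra).
    apply Rmult_le_compat_l; lra.
  - replace (1 / PI * ((INR n + 2) / (INR n + 1)))
      with ((INR n + 2) * (4 / PI ^ 2) * (PI / 2 / (2 * (INR n + 1)))) by (field; lra).
    apply Rmult_le_compat_l; lra.
Qed.

Lemma is_lim_seq_inv_INR (c : R) : 0 < c -> is_lim_seq (fun n => / (INR n + c)) 0.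
Proof.
  intros Hc.
  apply (is_lim_seq_inv (fun n => INR n + c) p_infty); [|discriminate].
  apply (is_lim_seq_plus INR (fun _ => c) p_infty c).
  - apply is_lim_seq_INR.
  - apply is_lim_seq_const.
  - reflexivity.
Qed.

Lemma is_lim_beta_sqr : is_lim_seq (fun n => (INR n + 1) * beta n ^ 2) (1 / PI).
Proof.
  assert (Hpi := PI_RGT_0).
  apply is_lim_seq_incr_1.
  apply (is_lim_seq_le_le
    (fun n => 2 / PI * (1 / 2 + / 4 * / (INR n + 3 / 2))) _
    (fun n => 1 / PI * (1 + / (INR n + 1)))).
  - intros n. assert (Hn := pos_INR n). assert (H := beta_bounds n).
    rewrite S_INR. replace (INR n + 1 + 1) with (INR n + 2) by ring.
    replace (1 / 2 + / 4 * / (INR n + 3 / 2)) with ((INR n + 2) / (2 * INR n + 3)) by (field; lra).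
    replace (1 + / (INR n + 1)) with ((INR n + 2) / (INR n + 1)) by (field; lra). exact H.
  - replace (1 / PI) with (2 / PI * (1 / 2 + / 4 * 0)) by (field; lra).
    apply (is_lim_seq_scal_l _ _ (Finite _)). apply is_lim_seq_plus'; [apply is_lim_seq_const|].
    apply (is_lim_seq_scal_l _ _ 0). apply is_lim_seq_inv_INR. lra.
  - assert (H : is_lim_seq (fun n => 1 / PI * (1 + / (INR n + 1))) (1 / PI * (1 + 0))).
    { apply (is_lim_seq_scal_l _ _ (Finite _)). apply is_lim_seq_plus'; [apply is_lim_seq_const|].
      apply is_lim_seq_inv_INR. lra. }
    rewrite Rplus_0_r, Rmult_1_r in H. exact H.
Qed.

Lemma beta_sqr_le1 (n : nat) : (INR n + 1) * beta n ^ 2 <= 1.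
Proof.
  induction n as [|n IH]; [simpl; lra|].
  cbn [beta]. rewrite S_INR, !plus_INR, mult_INR. simpl (INR 1). simpl (INR 2).
  assert (Hn := pos_INR n). set (m := INR n) in *.
  replace ((m + 1 + 1) * (beta n * (((1 + 1) * m + 1) / ((1 + 1) * m + (1 + 1)))) ^ 2)
    with ((m + 1) * beta n ^ 2 * ((m + 2) * (2 * m + 1) ^ 2 / (4 * (m + 1) ^ 3))) by (field; lra).
  assert (Hp : 0 < 4 * (m + 1) ^ 3) by (apply Rmult_lt_0_compat; [lra|apply pow_lt; lra]).
  assert (H : (m + 2) * (2 * m + 1) ^ 2 / (4 * (m + 1) ^ 3) <= 1).
  { apply (Rmult_le_reg_r (4 * (m + 1) ^ 3)); [exact Hp|].
    unfold Rdiv. rewrite Rmult_assoc, Rinv_l by lra. nra. }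
  apply Rle_trans with (1 * 1); [|lra].
  apply Rmult_le_compat; try assumption.
  - apply Rmult_le_pos; [lra|]. apply pow2_ge_0.
  - apply Rmult_le_pos; [|left; apply Rinv_0_lt_compat, Hp].
    apply Rmult_le_pos; [lra|apply pow2_ge_0].
Qed.

(* Taylor coefficients of sqrt (1 - z) *)
Definition sqrt_coef (n : nat) : R := match n with O => 1 | S m => - (beta m / (2 * (INR m + 1))) end.

(** Coefficient form of $2(1-z)B'=-B$ for $B=\sqrt{1-z}$. *)
Lemma sqrt_coef_rec (n : nat) : 2 * (INR n + 1) * sqrt_coef (S n) = (2 * INR n - 1) * sqrt_coef n.
Proof.
  destruct n as [|n]; cbn [sqrt_coef beta].
  - simpl. field.
  - rewrite S_INR, plus_INR, plus_INR, mult_INR. simpl (INR 1). simpl (INR 2).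
    assert (Hn := pos_INR n). field. lra.
Qed.

Lemma sum_f_R0_rev (u : nat -> R) (n : nat) :
  sum_f_R0 (fun k => u (n - k)%nat) n = sum_f_R0 u n.
Proof.
  revert u; induction n as [|n IH]; intros u; [reflexivity|].
  rewrite decomp_sum by lia. cbn [Init.Nat.pred].
  rewrite (sum_eq _ (fun k => u (n - k)%nat)) by reflexivity.
  rewrite IH, tech5. rewrite Nat.sub_0_r. ring.
Qed.

(** Coefficient form of $(1-z)(B^2)'=-B^2$. The auxiliary [T] holds the coefficients of $zB'B$, and
    symmetry of the convolution under reversal gives $2zB'B=z(B^2)'$. *)
Lemma sqrt_coef_mult_b_rec (n : nat) :
  (INR n + 1) * PS_mult sqrt_coef sqrt_coef (S n) = (INR n - 1) * PS_mult sqrt_coef sqrt_coef n.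
Proof.
  pose (T := fun n => sum_f_R0 (fun k => INR k * sqrt_coef k * sqrt_coef (n - k)%nat) n).
  assert (H2 : forall n, 2 * T n = INR n * PS_mult sqrt_coef sqrt_coef n).
  { intros m. assert (E : T m = sum_f_R0 (fun k => INR (m - k) * sqrt_coef (m - k)%nat * sqrt_coef k) m).
    { unfold T. rewrite <- sum_f_R0_rev. apply sum_eq. intros k Hk.
      replace (m - (m - k))%nat with k by lia. reflexivity. }
    replace (2 * T m) with (T m + T m) by ring. rewrite E at 2. unfold T, PS_mult.
    rewrite <- plus_sum, scal_sum. apply sum_eq. intros k Hk.
    rewrite minus_INR by exact Hk. ring. }
  assert (HT : 2 * T (S n) = 2 * T n - PS_mult sqrt_coef sqrt_coef n).
  { unfold T, PS_mult. rewrite decomp_sum by lia. simpl (INR 0). rewrite !Rmult_0_l, Rplus_0_l.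
    cbn [Init.Nat.pred]. rewrite !scal_sum, <- minus_sum. apply sum_eq. intros k Hk.
    replace (S n - S k)%nat with (n - k)%nat by lia.
    assert (E := sqrt_coef_rec k). rewrite S_INR.
    replace ((INR k + 1) * sqrt_coef (S k) * sqrt_coef (n - k)%nat * 2)
      with (2 * (INR k + 1) * sqrt_coef (S k) * sqrt_coef (n - k)%nat) by ring.
    rewrite E. ring. }
  assert (E1 := H2 (S n)). assert (E2 := H2 n). rewrite S_INR in E1. lra.
Qed.

Lemma sqrt_coef_mult_b (n : nat) : PS_mult sqrt_coef sqrt_coef n = match n with O => 1 | 1%nat => -1 | _ => 0 end.
Proof.
  assert (H0 : PS_mult sqrt_coef sqrt_coef 0 = 1) by (unfold PS_mult; simpl; ring).
  destruct n as [|n]; [exact H0|].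
  assert (H1 : PS_mult sqrt_coef sqrt_coef 1 = -1).
  { assert (E := sqrt_coef_mult_b_rec 0). rewrite H0 in E. simpl INR in E. lra. }
  induction n as [|n IH]; [exact H1|].
  assert (E := sqrt_coef_mult_b_rec (S n)). rewrite IH in E.
  assert (Hn := pos_INR n). rewrite S_INR in E.
  apply (Rmult_eq_reg_l (INR n + 1 + 1)); [|lra]. rewrite E.
  destruct n as [|n]; [simpl; ring|ring].
Qed.

Definition weight (n : nat) : R := INR n * sqrt (INR n).

Lemma weight_ge0 (n : nat) : 0 <= weight n.
Proof. apply Rmult_le_pos; [apply pos_INR|apply sqrt_pos]. Qed.

Lemma sqrt_coef_abs_S (n : nat) : Rabs (sqrt_coef (S n)) = beta n / (2 * (INR n + 1)).
Proof.
  cbn [sqrt_coef]. rewrite Rabs_Ropp. apply Rabs_pos_eq.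
  assert (H := beta_pos n). assert (Hn := pos_INR n).
  left. apply Rdiv_lt_0_compat; lra.
Qed.

Lemma weight_S_b_S (n : nat) : weight (S n) * sqrt_coef (S n) = - / 2 * sqrt ((INR n + 1) * beta n ^ 2).
Proof.
  assert (H := beta_pos n). assert (Hn := pos_INR n).
  rewrite sqrt_mult by (try apply pow2_ge_0; lra).
  rewrite <- (Rsqr_pow2 (beta n)), sqrt_Rsqr by lra.
  unfold weight. rewrite S_INR. cbn [sqrt_coef]. field. lra.
Qed.

Lemma is_lim_weight_b : is_lim_seq (fun n => weight n * sqrt_coef n) (- / 2 * sqrt (1 / PI)).
Proof.
  apply is_lim_seq_incr_1. eapply is_lim_seq_ext.
  { intros n. symmetry. apply weight_S_b_S. }
  apply (is_lim_seq_scal_l _ (- / 2) (Finite _)).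
  apply (is_lim_seq_continuous sqrt _ (1 / PI)); [|apply is_lim_beta_sqr].
  apply continuity_pt_sqrt. assert (Hpi := PI_RGT_0).
  left. apply Rdiv_lt_0_compat; lra.
Qed.

Lemma weight_b_bound (n : nat) : weight (S n) * Rabs (sqrt_coef n) <= 2.
Proof.
  destruct n as [|n].
  - unfold weight. simpl. rewrite sqrt_1, Rabs_R1. lra.
  - rewrite sqrt_coef_abs_S. unfold weight. rewrite !S_INR.
    assert (H := beta_pos n). assert (Hn := pos_INR n). assert (Hb := beta_sqr_le1 n).
    assert (Hs : sqrt (INR n + 1 + 1) * beta n <= 2).
    { rewrite <- (sqrt_pow2 (beta n)) by lra. rewrite <- sqrt_mult by (try apply pow2_ge_0; lra).
      rewrite <- (sqrt_pow2 2) by lra. apply sqrt_le_1_alt.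
      assert (H2 := pow2_ge_0 (beta n)). nra. }
    replace ((INR n + 1 + 1) * sqrt (INR n + 1 + 1) * (beta n / (2 * (INR n + 1))))
      with (sqrt (INR n + 1 + 1) * beta n * ((INR n + 2) / (2 * (INR n + 1)))) by (field; lra).
    apply Rle_trans with (2 * 1); [|lra]. apply Rmult_le_compat.
    + apply Rmult_le_pos; [apply sqrt_pos|lra].
    + left. apply Rdiv_lt_0_compat; lra.
    + exact Hs.
    + apply (Rmult_le_reg_r (2 * (INR n + 1))); [lra|].
      unfold Rdiv. rewrite Rmult_assoc, Rinv_l by lra. lra.
Qed.

Lemma sqrt_coef_abs_le1 (n : nat) : Rabs (sqrt_coef n) <= 1.
Proof.
  destruct n as [|n]; [simpl; rewrite Rabs_R1; lra|].
  rewrite sqrt_coef_abs_S. assert (H := beta_pos n). assert (Hn := pos_INR n).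
  assert (Hb := beta_sqr_le1 n).
  assert (beta n <= 1) by nra.
  apply (Rmult_le_reg_r (2 * (INR n + 1))); [lra|].
  unfold Rdiv. rewrite Rmult_assoc, Rinv_l by lra. lra.
Qed.

(** * Coefficient asymptotics *)

Lemma sum_n_diff_le (u M : nat -> R) (K n : nat) : (K <= n)%nat ->
  (forall k, Rabs (u k) <= M k) ->
  Rabs (sum_n u n - sum_n u K) <= sum_n M n - sum_n M K.
Proof.
  intros HK HM. induction HK as [|n HK IH].
  - rewrite !Rminus_diag. rewrite Rabs_R0. lra.
  - rewrite !sum_n_S. specialize (HM (S n)).
    replace (sum_n u n + u (S n) - sum_n u K) with (sum_n u n - sum_n u K + u (S n)) by ring.
    eapply Rle_trans; [apply Rabs_triang|]. lra.
Qed.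

Lemma sum_n_le_Series (M : nat -> R) (n : nat) :
  (forall k, 0 <= M k) -> ex_series M -> sum_n M n <= Series M.
Proof.
  intros H0 HM.
  apply (is_lim_seq_incr_compare (sum_n M) (Series M)).
  - apply Series_correct, HM.
  - intros k. rewrite sum_n_S. specialize (H0 (S k)). lra.
Qed.

(** Dominated convergence for sums whose range grows with [n]: a finite head converges termwise, and
    the tail of [M] controls the remainders of both [h n] and [l]. *)
Theorem tannery (h : nat -> nat -> R) (l M : nat -> R) :
  (forall n k, Rabs (h n k) <= M k) -> ex_series M ->
  (forall k, is_lim_seq (fun n => h n k) (l k)) ->
  is_lim_seq (fun n => sum_n (h n) n) (Series l).
Proof.
  intros HM Hex Hl.
  assert (M0 : forall k, 0 <= M k).
  { intros k. eapply Rle_trans; [apply Rabs_pos|apply (HM 0%nat)]. }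
  assert (HlM : forall k, Rabs (l k) <= M k).
  { intros k. apply (is_lim_seq_le (fun n => Rabs (h n k)) (fun _ => M k) (Rabs (l k)) (M k)).
    - intros n; apply HM.
    - apply (is_lim_seq_abs _ (l k)), Hl.
    - apply is_lim_seq_const. }
  assert (Hexl : ex_series l).
  { apply (ex_series_le (V := R_CompleteNormedModule) l M); [exact HlM|exact Hex]. }
  assert (Hfin : forall K, is_lim_seq (fun n => sum_n (h n) K) (sum_n l K)).
  { induction K as [|K IH].
    - rewrite sum_O. eapply is_lim_seq_ext; [|apply (Hl 0%nat)]. intros n. rewrite sum_O. reflexivity.
    - rewrite sum_n_S. eapply is_lim_seq_ext; [|apply (is_lim_seq_plus' _ _ _ _ IH (Hl (S K)))].
      intros n. simpl. rewrite sum_n_S. reflexivity. }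
  assert (Htail : forall K, Rabs (Series l - sum_n l K) <= Series M - sum_n M K).
  { intros K.
    apply (is_lim_seq_le_loc (fun n => Rabs (sum_n l n - sum_n l K)) (fun n => sum_n M n - sum_n M K)
      (Rabs (Series l - sum_n l K)) (Series M - sum_n M K)).
    - exists K. intros n Hn. apply sum_n_diff_le; assumption.
    - apply (is_lim_seq_abs _ (Finite _)). apply is_lim_seq_minus'; [|apply is_lim_seq_const].
      apply Series_correct, Hexl.
    - apply is_lim_seq_minus'; [|apply is_lim_seq_const]. apply Series_correct, Hex. }
  apply is_lim_seq_spec. intros eps.
  assert (He : 0 < eps / 4) by (assert (H := cond_pos eps); lra).
  assert (HK : exists K, Series M - sum_n M K < eps / 4).
  { assert (H : is_lim_seq (sum_n M) (Series M)) by apply (Series_correct _ Hex).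
    apply is_lim_seq_spec in H.
    destruct (H (mkposreal _ He)) as [K HK]. exists K.
    specialize (HK K (le_n K)). simpl in HK. apply Rabs_lt_between in HK. lra. }
  destruct HK as [K HK].
  assert (HN := Hfin K). apply is_lim_seq_spec in HN. destruct (HN (mkposreal _ He)) as [N HN'].
  exists (max K N). intros n Hn.
  specialize (HN' n ltac:(lia)). simpl in HN'.
  assert (H1 := sum_n_diff_le (h n) M K n ltac:(lia) (HM n)).
  assert (H2 := Htail K). assert (H3 := sum_n_le_Series M n M0 Hex).
  apply Rabs_lt_between in HN'. apply Rabs_le_between in H1. apply Rabs_le_between in H2.
  apply Rabs_lt_between. lra.
Qed.

Lemma CV_radius_ge_1 (u : nat -> R) (x : R) :
  (forall n, Rabs (u n) <= 1) -> Rabs x < 1 -> Rbar_lt (Rabs x) (CV_radius u).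
Proof.
  intros Hu Hx.
  apply (Rbar_lt_le_trans _ 1); [exact Hx|].
  apply (CV_radius_bounded u). exists 1. intros n. rewrite pow1, Rmult_1_r. apply Hu.
Qed.

Lemma ex_series_Rabs_pow (u : nat -> R) (x : R) :
  (forall n, Rabs (u n) <= 1) -> Rabs x < 1 -> ex_series (fun n => Rabs (u n * x ^ n)).
Proof. intros Hu Hx. apply CV_disk_inside, CV_radius_ge_1; assumption. Qed.

Lemma PSeries_series (u : nat -> R) (x : R) : PSeries u x = Series (fun n => u n * x ^ n).
Proof. reflexivity. Qed.

(** The terms after the constant 1 add up to at most $|x|/(1-|x|)<1$. This positivity fixes the
    signs of square roots near 0. *)
Lemma PSeries_pos (u : nat -> R) (x : R) :
  u 0%nat = 1 -> (forall n, Rabs (u n) <= 1) -> Rabs x < 1 / 2 -> 0 < PSeries u x.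
Proof.
  intros H0 Hu Hx.
  assert (Hex := ex_series_Rabs_pow u x Hu ltac:(lra)).
  rewrite PSeries_series, Series_incr_1 by (apply ex_series_Rabs, Hex).
  rewrite H0. simpl (x ^ 0). rewrite Rmult_1_r.
  assert (Hg : Rabs (Rabs x) < 1) by (rewrite Rabs_Rabsolu; lra).
  assert (Hex1 : ex_series (fun n => Rabs (u (S n) * x ^ S n))).
  { apply (ex_series_incr_1 (fun n => Rabs (u n * x ^ n))), Hex. }
  assert (B : Rabs (Series (fun n => u (S n) * x ^ S n)) <= Rabs x * / (1 - Rabs x)).
  { eapply Rle_trans; [apply Series_Rabs, Hex1|].
    rewrite <- (Series_geom (Rabs x)) by exact Hg. rewrite <- Series_scal_l.
    apply Series_le.
    - intros n. split; [apply Rabs_pos|]. rewrite Rabs_mult, <- RPow_abs.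
      rewrite <- (Rmult_1_l (Rabs x * Rabs x ^ n)).
      apply Rmult_le_compat; [apply Rabs_pos| |apply Hu|apply Rle_refl].
      apply pow_le, Rabs_pos.
    - apply (ex_series_scal_l (Rabs x) (fun n => Rabs x ^ n)). exists (/ (1 - Rabs x)).
      apply is_series_geom, Hg. }
  assert (B2 : Rabs x * / (1 - Rabs x) < 1).
  { apply (Rmult_lt_reg_r (1 - Rabs x)); [lra|]. rewrite Rmult_assoc, Rinv_l by lra. lra. }
  apply Rabs_le_between in B. lra.
Qed.

Lemma PSeries_fin3 (u : nat -> R) (A B C x : R) :
  (forall n, u n = match n with O => A | 1%nat => B | 2%nat => C | _ => 0 end) ->
  PSeries u x = A + B * x + C * x ^ 2.
Proof.
  intros Hu. apply is_series_unique.
  refine (is_series_ext _ _ _ _ (is_series_fin3 A (B * x) (C * x ^ 2))).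
  intros n. rewrite Hu. destruct n as [|[|[|n]]];
    match goal with |- ?x = ?y => change (@eq R x y) end; simpl; ring.
Qed.

Lemma PSeries_b_sqr (x : R) : Rabs x < 1 -> PSeries sqrt_coef x * PSeries sqrt_coef x = 1 - x.
Proof.
  intros Hx. assert (Hr := CV_radius_ge_1 sqrt_coef x sqrt_coef_abs_le1 Hx).
  rewrite <- PSeries_mult by exact Hr.
  rewrite (PSeries_fin3 _ 1 (-1) 0); [ring|]. intros n. rewrite sqrt_coef_mult_b.
  destruct n as [|[|[|n]]]; reflexivity.
Qed.

Lemma d_coef_Rabs_le1 (n : nat) : Rabs (d_coef n) <= 1.
Proof.
  destruct n as [|n]; simpl; [rewrite Rabs_R1; lra|].
  rewrite Rabs_Ropp. apply p_hit_Rabs_le1.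
Qed.

Definition balpha (n : nat) : R := sqrt_coef n * alpha ^ n.

Lemma balpha_abs_le1 (n : nat) : Rabs (balpha n) <= 1.
Proof.
  unfold balpha. rewrite Rabs_mult. assert (H := sqrt_coef_abs_le1 n).
  assert (Ha := alpha_bounds).
  assert (H2 : 0 <= alpha ^ n <= 1).
  { split; [apply pow_le; lra|]. rewrite <- (pow1 n). apply pow_incr. lra. }
  rewrite (Rabs_pos_eq (alpha ^ n)) by lra. assert (H3 := Rabs_pos (sqrt_coef n)). nra.
Qed.

Lemma PSeries_balpha (x : R) : PSeries balpha x = PSeries sqrt_coef (alpha * x).
Proof.
  apply Series_ext. intros n. unfold balpha. rewrite Rpow_mult_distr. ring.
Qed.

(** Near 0 the series $D(x)$ and $B(\alpha x)B(x)$ are positive with the same square, hence equal;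
    uniqueness of power series coefficients concludes. The factorization separates the singularity
    at 1 from the one at $1/\alpha$. *)
Lemma d_eq_PS_mult (n : nat) : d_coef n = PS_mult balpha sqrt_coef n.
Proof.
  assert (Hpos : forall u : nat -> R, (forall n, Rabs (u n) <= 1) -> Rbar_lt 0 (CV_radius u)).
  { intros u Hu. rewrite <- Rabs_R0. apply CV_radius_ge_1; [exact Hu|]. rewrite Rabs_R0. lra. }
  apply PSeries_ext_recip.
  - apply Hpos, d_coef_Rabs_le1.
  - assert (H : ex_pseries (PS_mult balpha sqrt_coef) (/ 2)).
    { assert (Hh : Rabs (/ 2) < 1) by (rewrite Rabs_pos_eq; lra).
      apply ex_pseries_mult; apply CV_radius_ge_1; try exact Hh.
      - apply balpha_abs_le1.
      - apply sqrt_coef_abs_le1. }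
    destruct (Rbar_lt_dec 0 (CV_radius (PS_mult balpha sqrt_coef))) as [Hd|Hd]; [exact Hd|exfalso].
    apply Rbar_not_lt_le in Hd.
    apply (CV_disk_outside (PS_mult balpha sqrt_coef) (/ 2)).
    + apply (Rbar_le_lt_trans _ 0); [exact Hd|]. simpl. rewrite Rabs_pos_eq; lra.
    + apply (ex_series_lim_0 (fun n => PS_mult balpha sqrt_coef n * (/ 2) ^ n)).
      apply ex_pseries_R in H. exact H.
  - exists (mkposreal (/ 2) ltac:(lra)). intros x Hx.
    assert (Hx' : Rabs x < 1 / 2).
    { change (Rabs (x - 0) < / 2) in Hx. rewrite Rminus_0_r in Hx. lra. }
    assert (Ha := alpha_bounds).
    assert (Hax : Rabs (alpha * x) < 1 / 2).
    { rewrite Rabs_mult, (Rabs_pos_eq alpha) by lra. assert (H := Rabs_pos x). nra. }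
    rewrite PSeries_mult by (apply CV_radius_ge_1; [apply balpha_abs_le1 || apply sqrt_coef_abs_le1|lra]).
    rewrite PSeries_balpha.
    assert (P1 := PSeries_pos d_coef x eq_refl d_coef_Rabs_le1 Hx').
    assert (P2 := PSeries_pos sqrt_coef x eq_refl sqrt_coef_abs_le1 Hx').
    assert (P3 := PSeries_pos sqrt_coef (alpha * x) eq_refl sqrt_coef_abs_le1 Hax).
    assert (E1 := PSeries_b_sqr x ltac:(lra)). assert (E2 := PSeries_b_sqr (alpha * x) ltac:(lra)).
    assert (E3 : PSeries d_coef x * PSeries d_coef x = (1 - x) * (1 - alpha * x)).
    { rewrite <- PSeries_mult by (apply CV_radius_ge_1; [apply d_coef_Rabs_le1|lra]).
      rewrite (PSeries_fin3 _ _ _ _ x d_mult_d). ring. }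
    rewrite <- E1, <- E2 in E3.
    set (X := PSeries d_coef x) in *. set (Y := PSeries sqrt_coef x) in *. set (Z := PSeries sqrt_coef (alpha * x)) in *.
    assert (HYZ : 0 < Z * Y) by (apply Rmult_lt_0_compat; assumption).
    assert (F : (X - Z * Y) * (X + Z * Y) = 0) by nra.
    apply Rmult_integral in F. destruct F; lra.
Qed.

(** From $n\le(n-k+1)(k+1)$ and monotonicity of $t^{3/2}$. The weight passes from $n$ to $n-k$ at
    the price of a factor in [k] alone, which $\alpha^k$ absorbs. *)
Lemma weight_le_mult (n k : nat) : (k <= n)%nat ->
  weight n <= weight (S (n - k)) * weight (S k).
Proof.
  intros Hk. unfold weight.
  assert (H1 := pos_INR n). assert (H2 := pos_INR (n - k)). assert (H3 := pos_INR k).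
  assert (E : INR n = INR (n - k) + INR k) by (rewrite <- plus_INR; f_equal; lia).
  rewrite !S_INR.
  replace ((INR (n - k) + 1) * sqrt (INR (n - k) + 1) * ((INR k + 1) * sqrt (INR k + 1)))
    with (((INR (n - k) + 1) * (INR k + 1)) * (sqrt (INR (n - k) + 1) * sqrt (INR k + 1))) by ring.
  rewrite <- sqrt_mult by lra.
  assert (L : INR n <= (INR (n - k) + 1) * (INR k + 1)) by nra.
  apply Rmult_le_compat; [lra|apply sqrt_pos|exact L|]. apply sqrt_le_1_alt, L.
Qed.

Lemma weight_S_le (k : nat) : weight (S k) <= 6 * 2 ^ k.
Proof.
  assert (H : (INR k + 1) ^ 2 + 2 * (INR k + 1) + 3 <= 6 * 2 ^ k).
  { induction k as [|k IH]; [simpl; lra|].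
    rewrite S_INR. assert (H := pos_INR k). change (2 ^ S k) with (2 * 2 ^ k). nra. }
  unfold weight. rewrite S_INR. assert (Hk := pos_INR k).
  assert (Hs : sqrt (INR k + 1) <= INR k + 1).
  { rewrite <- (sqrt_pow2 (INR k + 1)) at 2 by lra. apply sqrt_le_1_alt. nra. }
  nra.
Qed.

Lemma is_lim_weight_ratio : is_lim_seq (fun n => weight (S n) / weight n) 1.
Proof.
  apply (is_lim_seq_ext_loc (fun n => (1 + / (INR n + 0)) * sqrt (1 + / (INR n + 0)))).
  - exists 1%nat. intros n Hn. assert (Hp : 0 < INR n) by (apply lt_0_INR; lia).
    unfold weight. rewrite S_INR, Rplus_0_r.
    replace (1 + / INR n) with ((INR n + 1) / INR n) by (field; lra).
    rewrite sqrt_div_alt by lra. field. split; [|lra].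
    apply Rgt_not_eq, sqrt_lt_R0, Hp.
  - assert (L : is_lim_seq (fun n => 1 + / (INR n + 0)) 1).
    { replace (Finite 1) with (Finite (1 + 0)) by (f_equal; ring).
      apply is_lim_seq_plus'; [apply is_lim_seq_const|].
      apply (is_lim_seq_inv (fun n => INR n + 0) p_infty); [|discriminate].
      apply (is_lim_seq_ext INR); [intros; ring|apply is_lim_seq_INR]. }
    replace (Finite 1) with (Finite (1 * sqrt 1)) by (rewrite sqrt_1; f_equal; ring).
    apply is_lim_seq_mult'; [exact L|].
    apply (is_lim_seq_continuous sqrt _ 1); [|exact L].
    apply continuity_pt_sqrt. lra.
Qed.

Lemma is_lim_weight_ratio_inv : is_lim_seq (fun n => weight n / weight (S n)) 1.
Proof.
  assert (H := is_lim_seq_inv _ _ is_lim_weight_ratio).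
  specialize (H ltac:(intros E; injection E; lra)).
  simpl in H. rewrite Rinv_1 in H.
  eapply is_lim_seq_ext; [|exact H]. intros n. simpl.
  unfold Rdiv. rewrite Rinv_mult, Rinv_inv. ring.
Qed.

Lemma weight_S_pos (n : nat) : 0 < weight (S n).
Proof.
  unfold weight. assert (H : 0 < INR (S n)) by (apply lt_0_INR; lia).
  apply Rmult_lt_0_compat; [exact H|apply sqrt_lt_R0, H].
Qed.

Lemma is_lim_weight_shift (u : nat -> R) (L : R) :
  is_lim_seq (fun n => u n * weight n) L <-> is_lim_seq (fun n => u n * weight (S n)) L.
Proof.
  split; intros H.
  - assert (H2 := is_lim_seq_mult' _ _ _ _ H is_lim_weight_ratio).
    rewrite Rmult_1_r in H2. eapply is_lim_seq_ext_loc; [|exact H2].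
    exists 1%nat. intros [|n] Hn; [lia|]. assert (Hw := weight_S_pos n). simpl. field. lra.
  - assert (H2 := is_lim_seq_mult' _ _ _ _ H is_lim_weight_ratio_inv).
    rewrite Rmult_1_r in H2. eapply is_lim_seq_ext; [|exact H2].
    intros n. simpl. assert (Hw := weight_S_pos n). field. lra.
Qed.

Lemma Series_balpha : Series balpha = sqrt (1 - alpha).
Proof.
  assert (Ha := alpha_bounds).
  assert (Hax : Rabs alpha < 1 / 2) by (rewrite Rabs_pos_eq; lra).
  change (PSeries sqrt_coef alpha = sqrt (1 - alpha)).
  rewrite <- PSeries_b_sqr by lra.
  rewrite sqrt_square; [reflexivity|].
  left. apply (PSeries_pos sqrt_coef alpha eq_refl sqrt_coef_abs_le1 Hax).
Qed.

Definition casym : R := sqrt ((sqrt 2 - 1) / (2 * PI)).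

(** In $D=B(\alpha z)B(z)$ the first factor has geometrically small coefficients and the second has
    coefficients asymptotic to $-n^{-3/2}/(2\sqrt\pi)$. The limit is therefore that constant times
    $B(\alpha)=\sqrt{1-\alpha}$. *)
Lemma is_lim_weight_d : is_lim_seq (fun n => d_coef n * weight n) (- casym).
Proof.
  assert (Ha := alpha_bounds). assert (Hpi := PI_RGT_0).
  (* Beyond the diagonal truncated subtraction would give [n - k] the value 0; setting [h] to zero
     there confines the domination to $k\le n$ and leaves the sum up to [n] unchanged. *)
  pose (h := fun n k => if le_dec k n then balpha k * (weight n * sqrt_coef (n - k)%nat) else 0).
  assert (T : is_lim_seq (fun n => sum_n (h n) n)
               (Series (fun k => balpha k * (- / 2 * sqrt (1 / PI))))).
  (* The weights cost $2\cdot6\cdot2^k$, by [weight_b_bound] and [weight_S_le], and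
     $\alpha^k\le4^{-k}$ leaves this majorant. *)
  { apply (tannery h _ (fun k => 12 * (/ 2) ^ k)).
    - intros n k. unfold h. destruct (le_dec k n) as [Hk|Hk].
      + unfold balpha.
        replace (sqrt_coef k * alpha ^ k * (weight n * sqrt_coef (n - k)))
          with (sqrt_coef k * (alpha ^ k * (weight n * sqrt_coef (n - k)))) by ring.
        rewrite !Rabs_mult. rewrite (Rabs_pos_eq (weight n)) by apply weight_ge0.
        rewrite (Rabs_pos_eq (alpha ^ k)) by (apply pow_le; lra).
        assert (B1 : weight n * Rabs (sqrt_coef (n - k)) <= 12 * 2 ^ k).
        { assert (W := weight_le_mult n k Hk). assert (W2 := weight_S_le k).
          assert (W3 := weight_b_bound (n - k)). assert (W4 := Rabs_pos (sqrt_coef (n - k))).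
          assert (W5 := weight_ge0 (S k)).
          apply Rle_trans with (weight (S (n - k)) * weight (S k) * Rabs (sqrt_coef (n - k))).
          { apply Rmult_le_compat_r; assumption. }
          replace (weight (S (n - k)) * weight (S k) * Rabs (sqrt_coef (n - k)))
            with (weight (S (n - k)) * Rabs (sqrt_coef (n - k)) * weight (S k)) by ring.
          replace (12 * 2 ^ k) with (2 * (6 * 2 ^ k)) by ring.
          apply Rmult_le_compat; try assumption.
          apply Rmult_le_pos; [apply weight_ge0|assumption]. }
        assert (B2 := sqrt_coef_abs_le1 k).
        assert (B3 : 0 <= alpha ^ k) by (apply pow_le; lra).
        assert (B4 : 0 <= weight n * Rabs (sqrt_coef (n - k))).
        { apply Rmult_le_pos; [apply weight_ge0|apply Rabs_pos]. }
        assert (B5 : alpha ^ k * (weight n * Rabs (sqrt_coef (n - k))) <= 12 * (/ 2) ^ k).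
        { apply Rle_trans with ((/ 4) ^ k * (12 * 2 ^ k)).
          - apply Rmult_le_compat; try assumption. apply pow_incr. lra.
          - replace ((/ 4) ^ k * (12 * 2 ^ k)) with (12 * ((/ 4) ^ k * 2 ^ k)) by ring.
            rewrite <- Rpow_mult_distr. replace (/ 4 * 2) with (/ 2) by field. lra. }
        rewrite <- (Rmult_1_l (12 * (/ 2) ^ k)).
        apply Rmult_le_compat; try assumption; [apply Rabs_pos|].
        apply Rmult_le_pos; assumption.
      + rewrite Rabs_R0. apply Rmult_le_pos; [lra|]. apply pow_le. lra.
    - apply (ex_series_scal_l 12 (fun k => (/ 2) ^ k)). eexists. apply is_series_geom.
      rewrite Rabs_pos_eq; lra.
    - intros k. apply (is_lim_seq_incr_n _ k).
      apply (is_lim_seq_ext (fun n => balpha k * (weight (n + k) * sqrt_coef n))).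
      + intros n. unfold h. destruct (le_dec k (n + k)) as [Hk|Hk]; [|lia].
        replace (n + k - k)%nat with n by lia. reflexivity.
      + apply (is_lim_seq_scal_l _ _ (Finite _)).
        induction k as [|k IH].
        * eapply is_lim_seq_ext; [|apply is_lim_weight_b]. intros n. simpl.
          rewrite Nat.add_0_r. reflexivity.
        * assert (R1 : is_lim_seq (fun n => weight (S (n + k)) / weight (n + k)) 1).
          { apply (is_lim_seq_incr_n (fun n => weight (S n) / weight n) k), is_lim_weight_ratio. }
          assert (H2 := is_lim_seq_mult' _ _ _ _ IH R1). rewrite Rmult_1_r in H2.
          eapply is_lim_seq_ext_loc; [|exact H2]. exists 1%nat. intros n Hn. simpl.
          rewrite Nat.add_succ_r.
          assert (Hw : weight (n + k) <> 0).
          { destruct (n + k)%nat eqn:En; [lia|]. apply Rgt_not_eq, weight_S_pos. }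
          field. exact Hw. }
  assert (EC : Series (fun k => balpha k * (- / 2 * sqrt (1 / PI))) = - casym).
  { rewrite Series_scal_r, Series_balpha. unfold casym.
    assert (Hs := sqrt2_bounds).
    replace (sqrt 2 - 1) with ((1 - alpha) / 2) by (rewrite alpha_eq; field).
    replace ((1 - alpha) / 2 / (2 * PI)) with ((1 - alpha) * (1 / PI) / (2 ^ 2)) by (field; lra).
    rewrite (sqrt_div_alt ((1 - alpha) * (1 / PI)) (2 ^ 2)) by lra. rewrite (sqrt_pow2 2) by lra.
    rewrite sqrt_mult; [field|lra|]. left. apply Rdiv_lt_0_compat; lra. }
  rewrite EC in T. eapply is_lim_seq_ext; [|exact T].
  intros n. simpl. rewrite d_eq_PS_mult. unfold PS_mult. rewrite <- sum_n_Reals.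
  rewrite Rmult_comm. rewrite <- (sum_n_mult_l (K := R_Ring) (weight n)).
  apply sum_n_ext_loc. intros k Hk. unfold h. destruct (le_dec k n); [|lia].
  change (balpha k * (weight n * sqrt_coef (n - k)) = weight n * (balpha k * sqrt_coef (n - k))). ring.
Qed.

Theorem is_lim_weight_q : is_lim_seq (fun n => q_coef n * weight n) casym.
Proof.
  apply is_lim_weight_shift.
  assert (H := is_lim_weight_d). apply is_lim_seq_incr_1 in H.
  apply is_lim_seq_opp in H. simpl in H. rewrite Ropp_involutive in H.
  eapply is_lim_seq_ext; [|exact H]. intros n. simpl. ring.
Qed.

(** * Tails and the general starting point *)

(** A telescoping comparison sequence asymptotic to $k^{-3/2}$, with explicit tails $2/\sqrt k$. *)
Definition tele (k : nat) : R := 2 * (/ sqrt (INR k) - / sqrt (INR k + 1)).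

Lemma tele_weight (k : nat) : (0 < k)%nat ->
  tele k * weight k = 2 / (sqrt (1 + / INR k) * (sqrt (1 + / INR k) + 1)).
Proof.
  intros Hk. assert (Hp : 0 < INR k) by (apply lt_0_INR; lia).
  replace (1 + / INR k) with ((INR k + 1) / INR k) by (field; lra).
  rewrite sqrt_div_alt by lra. unfold tele, weight.
  assert (H1 := sqrt_sqrt (INR k) ltac:(lra)). assert (H2 := sqrt_sqrt (INR k + 1) ltac:(lra)).
  assert (H3 := sqrt_lt_R0 (INR k) Hp). assert (H4 := sqrt_lt_R0 (INR k + 1) ltac:(lra)).
  set (x := sqrt (INR k)) in *. set (y := sqrt (INR k + 1)) in *.
  rewrite <- H1 in *. assert (E : y * y = x * x + 1) by lra.
  apply (Rmult_eq_reg_r (y * (y + x))); [|nra].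
  transitivity (2 * x * x * ((y * y - x * x))); [field; lra|].
  transitivity (2 * x * x); [rewrite E; ring|field; repeat split; nra].
Qed.

Lemma is_lim_tele_weight : is_lim_seq (fun k => tele k * weight k) 1.
Proof.
  apply (is_lim_seq_ext_loc (fun k => 2 / (sqrt (1 + / INR k) * (sqrt (1 + / INR k) + 1)))).
  { exists 1%nat. intros k Hk. symmetry. apply tele_weight. lia. }
  assert (L : is_lim_seq (fun n => sqrt (1 + / INR n)) (sqrt (1 + 0))).
  { apply (is_lim_seq_continuous sqrt _ (1 + 0)); [apply continuity_pt_sqrt; lra|].
    apply is_lim_seq_plus'; [apply is_lim_seq_const|].
    apply (is_lim_seq_inv INR p_infty); [apply is_lim_seq_INR|discriminate]. }
  rewrite Rplus_0_r, sqrt_1 in L.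
  replace (Finite 1) with (Finite (2 / (1 * (1 + 1)))) by (f_equal; field).
  apply is_lim_seq_div'; [apply is_lim_seq_const| |lra].
  apply is_lim_seq_mult'; [exact L|]. apply is_lim_seq_plus'; [exact L|apply is_lim_seq_const].
Qed.

Lemma tele_pos (k : nat) : (0 < k)%nat -> 0 < tele k.
Proof.
  intros Hk. assert (Hp : 0 < INR k) by (apply lt_0_INR; lia). unfold tele.
  assert (H3 := sqrt_lt_R0 (INR k) Hp).
  assert (H : / sqrt (INR k + 1) < / sqrt (INR k)).
  { apply Rinv_lt_contravar; [apply Rmult_lt_0_compat; [exact H3|apply sqrt_lt_R0; lra]|].
    apply sqrt_lt_1_alt. lra. }
  lra.
Qed.

Lemma is_series_tele (k : nat) : is_series (fun l => tele (k + l)) (2 / sqrt (INR k)).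
Proof.
  assert (E : forall n, (sum_n (fun l => tele (k + l)) n : R)
              = 2 / sqrt (INR k) - 2 * / sqrt (INR (k + S n))).
  { induction n as [|n IH].
    - rewrite sum_O. unfold tele. rewrite !plus_INR. simpl (INR 0). simpl (INR 1).
      rewrite Rplus_0_r. unfold Rdiv. ring.
    - rewrite sum_n_S, IH. unfold tele.
      replace (INR (k + S (S n))) with (INR (k + S n) + 1) by (rewrite <- S_INR; f_equal; lia).
      ring. }
  apply (is_lim_seq_ext (fun n => 2 / sqrt (INR k) - 2 * / sqrt (INR (k + S n))) _
           (2 / sqrt (INR k))).
  { intros n. symmetry. apply E. }
  replace (Finite (2 / sqrt (INR k))) with (Finite (2 / sqrt (INR k) - 2 * 0)) by (f_equal; ring).
  apply is_lim_seq_minus'; [apply is_lim_seq_const|].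
  apply (is_lim_seq_scal_l _ 2 0).
  apply (is_lim_seq_inv (fun n => sqrt (INR (k + S n))) p_infty); [|discriminate].
  apply (filterlim_comp _ _ _ (fun n => INR (k + S n)) sqrt _ (Rbar_locally p_infty)).
  - apply (is_lim_seq_ext (fun n => INR (n + S k))); [intros; f_equal; lia|].
    apply (is_lim_seq_incr_n INR (S k)), is_lim_seq_INR.
  - apply filterlim_sqrt_p.
Qed.

(** Eventually [s] differs from [L * tele] by at most $\varepsilon/4$ times [tele]; summing over a
    tail keeps this relative error. The factor 2 is that of the tail $2/\sqrt k$ of [tele]. *)
Theorem tail_asymptotics (s : nat -> R) (L : R) : ex_series s ->
  is_lim_seq (fun k => s k * weight k) L ->
  is_lim_seq (fun k => Series (fun l => s (k + l)%nat) * sqrt (INR k)) (2 * L).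
Proof.
  intros Hs HL.
  assert (Hr : is_lim_seq (fun k => s k / tele k) L).
  { assert (H := is_lim_seq_div' _ _ _ _ HL is_lim_tele_weight ltac:(lra)).
    rewrite Rdiv_1_r in H. eapply is_lim_seq_ext_loc; [|exact H].
    exists 1%nat. intros [|n] Hn; [lia|]. assert (H1 := weight_S_pos n).
    assert (H2 := tele_pos (S n) ltac:(lia)). simpl. field. lra. }
  apply is_lim_seq_spec. intros eps.
  assert (He : 0 < eps / 4) by (assert (H := cond_pos eps); lra).
  apply is_lim_seq_spec in Hr. destruct (Hr (mkposreal _ He)) as [N HN]. simpl in HN.
  exists (S N). intros k Hk.
  assert (Hsk : ex_series (fun l => s (k + l)%nat)) by (apply (ex_series_incr_n s k), Hs).
  assert (Hek := is_series_tele k).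
  assert (Hd : forall l, Rabs (s (k + l)%nat - L * tele (k + l)) <= eps / 4 * tele (k + l)).
  { intros l. assert (Ht := tele_pos (k + l) ltac:(lia)). specialize (HN (k + l)%nat ltac:(lia)).
    replace (s (k + l)%nat - L * tele (k + l))
      with ((s (k + l)%nat / tele (k + l) - L) * tele (k + l)) by (field; lra).
    rewrite Rabs_mult, (Rabs_pos_eq (tele (k + l))) by lra.
    apply Rmult_le_compat_r; lra. }
  assert (Hex2 : ex_series (fun l => eps / 4 * tele (k + l))).
  { apply (ex_series_scal_l (eps / 4) (fun l => tele (k + l))). eexists; exact Hek. }
  assert (Hexa : ex_series (fun l => Rabs (s (k + l)%nat - L * tele (k + l)))).
  { apply (ex_series_le (V := R_CompleteNormedModule) _ (fun l => eps / 4 * tele (k + l)));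
      [|exact Hex2].
    intros l. unfold norm; simpl. unfold abs; simpl. rewrite Rabs_Rabsolu. apply Hd. }
  assert (B : Rabs (Series (fun l => s (k + l)%nat - L * tele (k + l)))
              <= eps / 4 * (2 / sqrt (INR k))).
  { eapply Rle_trans; [apply Series_Rabs, Hexa|].
    rewrite <- (is_series_unique _ _ Hek), <- Series_scal_l.
    apply Series_le; [|exact Hex2]. intros l. split; [apply Rabs_pos|apply Hd]. }
  rewrite Series_minus in B; [|exact Hsk|].
  2: { apply (ex_series_scal_l L (fun l => tele (k + l))). eexists; exact Hek. }
  rewrite Series_scal_l, (is_series_unique _ _ Hek) in B.
  assert (Hp : 0 < sqrt (INR k)) by (apply sqrt_lt_R0, lt_0_INR; lia).
  set (T := Series (fun l => s (k + l)%nat)) in *.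
  replace (T * sqrt (INR k) - 2 * L) with ((T - L * (2 / sqrt (INR k))) * sqrt (INR k)) by (field; lra).
  rewrite Rabs_mult, (Rabs_pos_eq (sqrt (INR k))) by lra.
  apply Rle_lt_trans with (eps / 4 * (2 / sqrt (INR k)) * sqrt (INR k)).
  - apply Rmult_le_compat_r; lra.
  - replace (eps / 4 * (2 / sqrt (INR k)) * sqrt (INR k)) with (eps / 2) by (field; lra).
    assert (H := cond_pos eps). lra.
Qed.

(** * Propagation of generating function and asymptotics from the origin *)

Definition is_gf (s : nat -> R) (z l : C) : Prop := is_series (fun k => (s k * z ^ k)%C) l.

Lemma is_gf_ext (s t : nat -> R) (z l m : C) :
  (forall k, s k = t k) -> l = m -> is_gf s z l -> is_gf t z m.
Proof.
  intros E <-. apply (is_series_ext (K := C_AbsRing) (V := C_NormedModule)).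
  intros k. rewrite E. reflexivity.
Qed.

Lemma is_gf_plus (s t : nat -> R) (z l m : C) :
  is_gf s z l -> is_gf t z m -> is_gf (fun k => s k + t k) z (l + m)%C.
Proof.
  intros H1 H2. unfold is_gf.
  refine (is_series_ext (K := C_AbsRing) (V := C_NormedModule) _ _ _ _
            (is_series_plus (K := C_AbsRing) (V := C_NormedModule) _ _ _ _ H1 H2)).
  intros k. rewrite RtoC_plus.
  change (s k * z ^ k + t k * z ^ k = (s k + t k) * z ^ k)%C. ring.
Qed.

Lemma is_gf_scal (s : nat -> R) (r : R) (z l : C) :
  is_gf s z l -> is_gf (fun k => r * s k) z (r * l)%C.
Proof.
  intros H1. unfold is_gf.
  refine (is_series_ext (K := C_AbsRing) (V := C_NormedModule) _ _ _ _
            (is_series_scal (K := C_AbsRing) (V := C_NormedModule) (RtoC r) _ _ H1)).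
  intros k. rewrite RtoC_mult.
  change (r * (s k * z ^ k) = r * s k * z ^ k)%C. ring.
Qed.

Lemma is_gf_shift (s : nat -> R) (z l : C) : z <> 0 ->
  is_gf s z l -> is_gf (fun k => s (S k)) z ((l - s 0%nat) / z)%C.
Proof.
  intros Hz H. unfold is_gf.
  assert (H1 : is_series (K := C_AbsRing) (V := C_NormedModule)
                 (fun k => (s (S k) * z ^ S k)%C) (l - s 0%nat)%C).
  { apply (is_series_incr_1 (K := C_AbsRing) (V := C_NormedModule) (fun k => (s k * z ^ k)%C)).
    refine (eq_ind l (is_series (K := C_AbsRing) (V := C_NormedModule) _) H _ _).
    change (l = (l - s 0%nat) + s 0%nat * 1)%C. ring. }
  replace ((l - s 0%nat) / z)%C with (/ z * (l - s 0%nat))%C by (field; exact Hz).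
  refine (is_series_ext (K := C_AbsRing) (V := C_NormedModule) _ _ _ _
            (is_series_scal (K := C_AbsRing) (V := C_NormedModule) (/ z)%C _ _ H1)).
  intros k. change (/ z * (s (S k) * (z * z ^ k)) = s (S k) * z ^ k)%C. field. exact Hz.
Qed.

Lemma is_gf_cons (s : nat -> R) (z l : C) (c : R) : is_gf s z l ->
  is_gf (fun k => match k with O => c | S k' => s k' end) z (c + z * l)%C.
Proof.
  intros H. unfold is_gf.
  apply (is_series_decr_1 (K := C_AbsRing) (V := C_NormedModule)).
  refine (eq_ind (z * l)%C (is_series (K := C_AbsRing) (V := C_NormedModule) _) _ _ _).
  2: { change (z * l = (c + z * l) + - (c * 1))%C. ring. }
  refine (is_series_ext (K := C_AbsRing) (V := C_NormedModule) _ _ _ _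
            (is_series_scal (K := C_AbsRing) (V := C_NormedModule) z _ _ H)).
  intros k. change (z * (s k * z ^ k) = s k * (z * z ^ k))%C. ring.
Qed.

Lemma is_gf_q_coef (z : C) : Cmod z <= 1 -> z <> 0 -> is_gf q_coef z ((1 - sq_factor z) / z)%C.
Proof.
  intros Hz Hz0. assert (H := is_series_Dgen z Hz). rewrite (Dgen_eq z Hz) in H.
  apply (is_gf_shift d_coef z _ Hz0) in H. apply (is_gf_scal _ (-1)) in H.
  refine (is_gf_ext _ _ _ _ _ _ _ H).
  - intros k. simpl. ring.
  - simpl. field. exact Hz0.
Qed.

(** The identity and the limit are bundled because both are linear in [s]: tying them to the same
    [gamma] makes $g(1)$ the asymptotic constant without any transfer theorem for general $f$ and
    $g$. *)
Definition slit_form (s : nat -> R) (phi gamma : R) : Prop :=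
  (exists f g, isLaurent inQ f /\ isLaurent inK g /\ f (RtoC 1) = phi /\ g (RtoC 1) = gamma /\
     forall z : C, Cmod z <= 1 -> z <> 0 -> is_gf s z (f z - g z * sq_factor z)%C) /\
  is_lim_seq (fun k => s k * weight k) (casym * gamma).

Lemma slit_form_ext (s t : nat -> R) (phi phi' gamma gamma' : R) :
  (forall k, s k = t k) -> phi = phi' -> gamma = gamma' ->
  slit_form s phi gamma -> slit_form t phi' gamma'.
Proof.
  intros E <- <- [[f [g [H1 [H2 [H3 [H4 H5]]]]]] H6]. split.
  - exists f, g. repeat split; try assumption.
    intros z Hz Hz0. exact (is_gf_ext _ _ _ _ _ E eq_refl (H5 z Hz Hz0)).
  - eapply is_lim_seq_ext; [|exact H6]. intros k. simpl. rewrite E. reflexivity.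
Qed.

Lemma slit_form_plus (s t : nat -> R) (phi phi' gamma gamma' : R) :
  slit_form s phi gamma -> slit_form t phi' gamma' ->
  slit_form (fun k => s k + t k) (phi + phi') (gamma + gamma').
Proof.
  intros [[f [g [H1 [H2 [H3 [H4 H5]]]]]] H6] [[f' [g' [K1 [K2 [K3 [K4 K5]]]]]] K6]. split.
  - exists (fun z => (f z + f' z)%C), (fun z => (g z + g' z)%C). repeat split.
    + apply isLaurent_plus; [apply coef_ring_Q| |]; assumption.
    + apply isLaurent_plus; [apply coef_ring_K| |]; assumption.
    + rewrite H3, K3, RtoC_plus. reflexivity.
    + rewrite H4, K4, RtoC_plus. reflexivity.
    + intros z Hz Hz0.
      refine (is_gf_ext _ _ _ _ _ _ _ (is_gf_plus _ _ _ _ _ (H5 z Hz Hz0) (K5 z Hz Hz0)));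
        [reflexivity|ring].
  - rewrite Rmult_plus_distr_l. eapply is_lim_seq_ext; [|exact (is_lim_seq_plus' _ _ _ _ H6 K6)].
    intros k. simpl. ring.
Qed.

Lemma slit_form_scal (s : nat -> R) (r phi gamma : R) : inQ r ->
  slit_form s phi gamma -> slit_form (fun k => r * s k) (r * phi) (r * gamma).
Proof.
  intros Hr [[f [g [H1 [H2 [H3 [H4 H5]]]]]] H6]. split.
  - exists (fun z => (r * f z)%C), (fun z => (r * g z)%C). repeat split.
    + apply isLaurent_scal; [apply coef_ring_Q| |]; assumption.
    + apply isLaurent_scal; [apply coef_ring_K|apply inQ_inK|]; assumption.
    + rewrite H3, RtoC_mult. reflexivity.
    + rewrite H4, RtoC_mult. reflexivity.
    + intros z Hz Hz0.
      refine (is_gf_ext _ _ _ _ _ _ _ (is_gf_scal _ r _ _ (H5 z Hz Hz0))); [reflexivity|ring].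
  - replace (casym * (r * gamma)) with (r * (casym * gamma)) by ring.
    eapply is_lim_seq_ext; [|exact (is_lim_seq_scal_l _ r _ H6)]. intros k. simpl. ring.
Qed.

(** With $S$ the square root, $(f-gS-s_0)/z+s_0(1-S)/z=f/z-S(g+s_0)/z$. The number $s_0$, in general
    irrational, cancels from $f$. *)
Lemma slit_form_right (s : nat -> R) (phi gamma : R) : inK (s 0%nat) ->
  slit_form s phi gamma ->
  slit_form (fun k => s (S k) + s 0%nat * q_coef k) phi (gamma + s 0%nat).
Proof.
  intros Hs0 [[f [g [H1 [H2 [H3 [H4 H5]]]]]] H6]. split.
  - exists (fun z => (f z / z)%C), (fun z => ((g z + s 0%nat) / z)%C). repeat split.
    + apply isLaurent_divz, H1.
    + apply (isLaurent_divz _ (fun z => (g z + s 0%nat)%C)).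
      apply isLaurent_plus; [apply coef_ring_K|exact H2|apply isLaurent_const, Hs0].
    + rewrite H3. field.
    + rewrite H4, RtoC_plus. field.
    + intros z Hz Hz0.
      refine (is_gf_ext _ _ _ _ _ _ _ (is_gf_plus _ _ _ _ _ (is_gf_shift _ _ _ Hz0 (H5 z Hz Hz0))
        (is_gf_scal _ (s 0%nat) _ _ (is_gf_q_coef z Hz Hz0)))); [reflexivity|field; exact Hz0].
  - apply is_lim_seq_incr_1 in H6. apply is_lim_weight_shift in H6.
    rewrite Rmult_plus_distr_l.
    assert (H7 := is_lim_seq_scal_l _ (s 0%nat) _ is_lim_weight_q). simpl in H7.
    rewrite (Rmult_comm casym (s 0%nat)).
    eapply is_lim_seq_ext; [|exact (is_lim_seq_plus' _ _ _ _ H6 H7)]. intros k. simpl. ring.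
Qed.

(** The inverse move, with [c] in the role of the tip probability at the new point:
    $c+z(f-gS)-c(1-S)=zf-(zg-c)S$, so [c] again cancels from $f$. *)
Lemma slit_form_left (s : nat -> R) (c phi gamma : R) : inK c ->
  slit_form s phi gamma ->
  slit_form (fun k => match k with O => c | S k' => s k' - c * q_coef k' end) phi (gamma - c).
Proof.
  intros Hc [[f [g [H1 [H2 [H3 [H4 H5]]]]]] H6]. split.
  - exists (fun z => (z * f z)%C), (fun z => (z * g z + (- c)%R)%C). repeat split.
    + apply isLaurent_mulz, H1.
    + apply isLaurent_plus; [apply coef_ring_K|apply isLaurent_mulz, H2|].
      apply isLaurent_const, inK_opp, Hc.
    + rewrite H3. ring.
    + rewrite H4. unfold Rminus. rewrite RtoC_plus. ring.
    + intros z Hz Hz0.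
      refine (is_gf_ext _ _ _ _ _ _ _ (is_gf_cons _ _ _ c (is_gf_plus _ _ _ _ _ (H5 z Hz Hz0)
        (is_gf_scal _ (- c) _ _ (is_gf_q_coef z Hz Hz0))))).
      * intros [|k]; simpl; ring.
      * rewrite RtoC_opp. field. exact Hz0.
  - apply is_lim_seq_incr_1.
    apply (proj1 (is_lim_weight_shift (fun k => s k - c * q_coef k) _)).
    replace (casym * (gamma - c)) with (casym * gamma - c * casym) by ring.
    assert (H7 := is_lim_seq_scal_l _ c _ is_lim_weight_q). simpl in H7.
    eapply is_lim_seq_ext; [|exact (is_lim_seq_minus' _ _ _ _ H6 H7)]. intros k. simpl. ring.
Qed.

Definition p_form (x y : Z) : Prop := exists gamma, slit_form (p_hit x y) 1 gamma.

(** The seed lies on the slit, where the generating function is the constant 1: $f=1$ and $g=0$. One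
    move to the right gives $f=g=1/z$ at $(1,0)$. *)
Lemma p_form_origin : p_form 0 0.
Proof.
  exists 0. split.
  - exists (fun _ => RtoC 1), (fun _ => RtoC 0). repeat split.
    + apply isLaurent_const, (inQ_Z 1).
    + apply isLaurent_const, (inK_Z 0).
    + intros z Hz Hz0.
      assert (H0 : is_gf (fun _ => 0) z 0).
      { assert (H1 : is_series (fun _ : nat => 0) 0).
        { apply (is_lim_seq_ext (fun _ => 0) (sum_n (fun _ : nat => 0)) 0);
            [|apply is_lim_seq_const].
          intros n. rewrite sum_n_const. ring. }
        unfold is_gf. apply is_series_C; refine (is_series_ext _ _ _ _ H1);
          intros n; simpl; match goal with |- ?a = ?b => change (@eq R a b) end; ring. }
      refine (is_gf_ext _ _ _ _ _ _ _ (is_gf_cons _ _ _ 1 H0)); [|ring].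
      intros [|k]; rewrite p_hit_slit by lia; [reflexivity|].
      destruct (Z.eqb_spec 0 (- Z.of_nat (S k))); [lia|reflexivity].
  - rewrite Rmult_0_r. apply is_lim_seq_incr_1.
    apply (is_lim_seq_ext (fun _ => 0)); [|apply is_lim_seq_const].
    intros k. rewrite p_hit_slit by lia.
    destruct (Z.eqb_spec 0 (- Z.of_nat (S k))); [lia|ring].
Qed.

Lemma p_form_right (x y : Z) : p_form x y -> p_form (x + 1) y.
Proof.
  intros [gamma H]. exists (gamma + p0 x y).
  refine (slit_form_ext _ _ _ _ _ _ _ eq_refl eq_refl (slit_form_right _ _ _ (inK_p0 x y) H)).
  intros k. symmetry. apply p_hit_shift.
Qed.

Lemma p_form_left (x y : Z) : p_form x y -> p_form (x - 1) y.
Proof.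
  intros [gamma H]. exists (gamma - p0 (x - 1) y).
  refine (slit_form_ext _ _ _ _ _ _ _ eq_refl eq_refl (slit_form_left _ _ _ _ (inK_p0 (x - 1) y) H)).
  intros [|k]; [reflexivity|].
  assert (E := p_hit_shift (x - 1) y k). replace (x - 1 + 1)%Z with x in E by lia.
  unfold p0, q_coef. lra.
Qed.

Lemma p_form_row (x x' y : Z) : p_form x y -> p_form x' y.
Proof.
  intros H.
  assert (Hr : forall n : nat, p_form (x + Z.of_nat n) y).
  { induction n as [|n IH].
    - replace (x + Z.of_nat 0)%Z with x by lia. exact H.
    - replace (x + Z.of_nat (S n))%Z with (x + Z.of_nat n + 1)%Z by lia. apply p_form_right, IH. }
  assert (Hl : forall n : nat, p_form (x - Z.of_nat n) y).
  { induction n as [|n IH].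
    - replace (x - Z.of_nat 0)%Z with x by lia. exact H.
    - replace (x - Z.of_nat (S n))%Z with (x - Z.of_nat n - 1)%Z by lia. apply p_form_left, IH. }
  destruct (Z_le_gt_dec x x').
  - replace x' with (x + Z.of_nat (Z.to_nat (x' - x)))%Z by lia. apply Hr.
  - replace x' with (x - Z.of_nat (Z.to_nat (x - x')))%Z by lia. apply Hl.
Qed.

(** One point per row suffices, by [p_form_row]. The column $x=1$ never meets the slit, so
    harmonicity at $(1,y)$ can be solved for the point above. *)
Lemma p_form_up (y : Z) : (forall x, p_form x y) -> (forall x, p_form x (y - 1)) ->
  p_form 1 (y + 1).
Proof.
  intros H H'. destruct (H 1%Z) as [g1 H1]. destruct (H 2%Z) as [g2 H2].
  destruct (H 0%Z) as [g3 H3]. destruct (H' 1%Z) as [g4 H4].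
  exists (4 * g1 + (-1) * g2 + (-1) * g3 + (-1) * g4).
  refine (slit_form_ext _ _ _ _ _ _ _ _ eq_refl
    (slit_form_plus _ _ _ _ _ _ (slit_form_plus _ _ _ _ _ _ (slit_form_plus _ _ _ _ _ _
      (slit_form_scal _ 4 _ _ (inQ_Z 4) H1) (slit_form_scal _ (-1) _ _ (inQ_Z (-1)) H2))
      (slit_form_scal _ (-1) _ _ (inQ_Z (-1)) H3)) (slit_form_scal _ (-1) _ _ (inQ_Z (-1)) H4))).
  - intros k. assert (E := p_hit_harmonic 1 y k ltac:(apply inH_false_iff; lia)).
    unfold harmonic_at in E. change (1 + 1)%Z with 2%Z in E. change (1 - 1)%Z with 0%Z in E. lra.
  - ring.
Qed.

(** Row -1 is not yet available, but by symmetry it equals row 1; harmonicity at $(1,0)$ then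
    determines twice the wanted value, whence the coefficients $-1/2$. *)
Lemma p_form_row1 : p_form 1 1.
Proof.
  assert (H : forall x, p_form x 0) by (intros x; apply (p_form_row 0), p_form_origin).
  destruct (H 1%Z) as [g1 H1]. destruct (H 2%Z) as [g2 H2]. destruct (H 0%Z) as [g3 H3].
  assert (Hm : inQ (-1 * / 2)) by (apply inQ_mult; [apply (inQ_Z (-1))|apply inQ_half]).
  exists (2 * g1 + (-1 * / 2) * g2 + (-1 * / 2) * g3).
  refine (slit_form_ext _ _ _ _ _ _ _ _ eq_refl
    (slit_form_plus _ _ _ _ _ _ (slit_form_plus _ _ _ _ _ _
      (slit_form_scal _ 2 _ _ (inQ_Z 2) H1) (slit_form_scal _ _ _ _ Hm H2))
      (slit_form_scal _ _ _ _ Hm H3))).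
  - intros k. assert (E := p_hit_harmonic 1 0 k ltac:(apply inH_false_iff; lia)).
    unfold harmonic_at in E. change (1 + 1)%Z with 2%Z in E. change (1 - 1)%Z with 0%Z in E.
    change (0 + 1)%Z with 1%Z in E. change (0 - 1)%Z with (- (1))%Z in E.
    rewrite p_hit_symm in E. lra.
  - field.
Qed.

Theorem p_form_all (x y : Z) : p_form x y.
Proof.
  assert (H0 : forall x, p_form x 0) by (intros a; apply (p_form_row 0), p_form_origin).
  assert (Hn : forall n, (forall x, p_form x (Z.of_nat n)) /\ (forall x, p_form x (Z.of_nat (S n)))).
  { induction n as [|n [IH1 IH2]]; split.
    - exact H0.
    - intros a. apply (p_form_row 1), p_form_row1.
    - exact IH2.
    - intros a. apply (p_form_row 1).
      replace (Z.of_nat (S (S n))) with (Z.of_nat (S n) + 1)%Z by lia. apply p_form_up.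
      + exact IH2.
      + replace (Z.of_nat (S n) - 1)%Z with (Z.of_nat n) by lia. exact IH1. }
  destruct (Hn (Z.to_nat (Z.abs y))) as [H _]. specialize (H x).
  rewrite Z2Nat.id in H by lia. destruct H as [g H]. exists g.
  refine (slit_form_ext _ _ _ _ _ _ _ eq_refl eq_refl H). intros k. apply p_hit_abs.
Qed.

(** * Nonvanishing of the asymptotic constant *)

Definition tail_coef (x y : Z) (gamma : R) : Prop :=
  is_lim_seq (fun k => p_hit x y k * weight k) (casym * gamma).

Lemma casym_pos : 0 < casym.
Proof.
  assert (Hpi := PI_RGT_0). assert (Hs := sqrt2_bounds).
  apply sqrt_lt_R0, Rdiv_lt_0_compat; lra.
Qed.

Lemma tail_coef_ex (x y : Z) : exists gamma, tail_coef x y gamma.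
Proof. destruct (p_form_all x y) as [g [_ H]]. exists g. exact H. Qed.

Lemma tail_coef_unique (x y : Z) (g g' : R) : tail_coef x y g -> tail_coef x y g' -> g = g'.
Proof.
  intros H H'. apply is_lim_seq_unique in H. apply is_lim_seq_unique in H'.
  rewrite H in H'. injection H' as E. assert (Hc := casym_pos).
  apply (Rmult_eq_reg_l casym); lra.
Qed.

Lemma tail_coef_ge0 (x y : Z) (g : R) : tail_coef x y g -> 0 <= g.
Proof.
  intros H. assert (Hc := casym_pos).
  assert (H0 : 0 <= casym * g).
  { apply (is_lim_seq_le (fun _ => 0) (fun k => p_hit x y k * weight k) 0 (casym * g)).
    - intros k. apply Rmult_le_pos; [apply p_hit_ge0|apply weight_ge0].
    - apply is_lim_seq_const.
    - exact H. }
  nra.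
Qed.

(* Minimum principle: the tail coefficient is nonnegative and harmonic. *)
Lemma tail_coef_zero_nbr (x y : Z) : inH x y = false -> tail_coef x y 0 ->
  tail_coef (x + 1) y 0 /\ tail_coef (x - 1) y 0 /\ tail_coef x (y + 1) 0 /\ tail_coef x (y - 1) 0.
Proof.
  intros Hin H.
  destruct (tail_coef_ex (x + 1) y) as [g1 H1]. destruct (tail_coef_ex (x - 1) y) as [g2 H2].
  destruct (tail_coef_ex x (y + 1)) as [g3 H3]. destruct (tail_coef_ex x (y - 1)) as [g4 H4].
  assert (P1 := tail_coef_ge0 _ _ _ H1). assert (P2 := tail_coef_ge0 _ _ _ H2).
  assert (P3 := tail_coef_ge0 _ _ _ H3). assert (P4 := tail_coef_ge0 _ _ _ H4).
  assert (E : tail_coef x y (/ 4 * (g1 + g2 + g3 + g4))).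
  { unfold tail_coef.
    replace (casym * (/ 4 * (g1 + g2 + g3 + g4)))
      with (/ 4 * (casym * g1 + casym * g2 + casym * g3 + casym * g4)) by ring.
    assert (HS := is_lim_seq_plus' _ _ _ _ (is_lim_seq_plus' _ _ _ _
                    (is_lim_seq_plus' _ _ _ _ H1 H2) H3) H4).
    eapply is_lim_seq_ext; [|exact (is_lim_seq_scal_l _ (/ 4) _ HS)].
    intros k. simpl. assert (E := p_hit_harmonic x y k Hin). unfold harmonic_at in E.
    replace (p_hit x y k) with (/ 4 * (4 * p_hit x y k)) by field. rewrite E. ring. }
  assert (E0 := tail_coef_unique _ _ _ _ H E).
  assert (g1 = 0) by lra. assert (g2 = 0) by lra. assert (g3 = 0) by lra. assert (g4 = 0) by lra.
  subst. repeat split; assumption.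
Qed.

Lemma tail_coef_10 : tail_coef 1 0 1.
Proof. unfold tail_coef. rewrite Rmult_1_r. apply is_lim_weight_q. Qed.

(** A zero would spread from neighbour to neighbour along a path off the slit: to the right until
    the abscissa is positive, vertically to the axis, then left to $(1,0)$, where the constant is 1.
    A move to the right from a point off the slit never enters it. *)
Theorem tail_coef_neq0 (x y : Z) (g : R) : inH x y = false -> tail_coef x y g -> g <> 0.
Proof.
  intros Hin H ->.
  assert (Haxis : forall n, ~ tail_coef (Z.of_nat (S n)) 0 0).
  { induction n as [|n IH]; intros Hz.
    - assert (E := tail_coef_unique _ _ _ _ Hz tail_coef_10). lra.
    - apply IH. replace (Z.of_nat (S n)) with (Z.of_nat (S (S n)) - 1)%Z by lia.
      apply (tail_coef_zero_nbr (Z.of_nat (S (S n))) 0); [apply inH_false_iff; lia|exact Hz]. }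
  assert (Hright : forall n x y, (0 < x)%Z -> Z.abs y = Z.of_nat n -> ~ tail_coef x y 0).
  { induction n as [|n IH]; intros a c Ha Hc Hz.
    - assert (c = 0)%Z by lia. subst c. apply (Haxis (Z.to_nat (a - 1))).
      replace (Z.of_nat (S (Z.to_nat (a - 1)))) with a by lia. exact Hz.
    - destruct (tail_coef_zero_nbr a c ltac:(apply inH_false_iff; lia) Hz) as [_ [_ [Hu Hd]]].
      destruct (Z_le_gt_dec 0 c).
      + apply (IH a (c - 1)%Z); [lia|lia|exact Hd].
      + apply (IH a (c + 1)%Z); [lia|lia|exact Hu]. }
  assert (Hall : forall n : nat, tail_coef (x + Z.of_nat n) y 0).
  { induction n as [|n IH].
    - replace (x + Z.of_nat 0)%Z with x by lia. exact H.
    - replace (x + Z.of_nat (S n))%Z with (x + Z.of_nat n + 1)%Z by lia.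
      apply (tail_coef_zero_nbr (x + Z.of_nat n) y); [|exact IH].
      apply inH_false_iff. apply inH_false_iff in Hin. lia. }
  apply (Hright (Z.to_nat (Z.abs y)) (x + Z.of_nat (Z.to_nat (1 - x)))%Z y); [lia|lia|apply Hall].
Qed.

Theorem mainTheorem17 :
  (forall i j : Z, inH i j = false ->
    exists (mf : Z) (fc : list Q) (mg : Z) (gc : list (Q * Q)),
      laurentQ mf fc (RtoC 1) = RtoC 1 /\
      laurentQs2 mg gc (RtoC 1) <> RtoC 0 /\
      (forall z : C, Cmod z <= 1 -> z <> RtoC 0 ->
         is_series (fun k : nat => Cmult (RtoC (p_hit i j k)) (Cpow z k))
           (Cminus (laurentQ mf fc z)
                   (Cmult (laurentQs2 mg gc z) (sq_factor z)))) /\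
      (forall g1 : R, RtoC g1 = laurentQs2 mg gc (RtoC 1) ->
         is_lim_seq
           (fun k : nat => p_hit i j k /
              (g1 * sqrt ((sqrt 2 - 1) / (2 * PI)) / (INR k * sqrt (INR k))))
           1 /\
         exists T : nat -> R,
           (forall k : nat, is_series (fun l : nat => p_hit i j (k + l)) (T k)) /\
           is_lim_seq
             (fun k : nat => T k /
                (g1 * sqrt (2 * (sqrt 2 - 1) / PI) / sqrt (INR k)))
             1)) /\
  (forall z : C, Cmod z <= 1 -> z <> RtoC 0 ->
     is_series (fun k : nat => Cmult (RtoC (p_hit 1 0 k)) (Cpow z k))
       (Cminus (Cinv z) (Cmult (Cinv z) (sq_factor z)))).
Proof.
  split.
  - intros i j Hin.
    destruct (p_form_all i j) as [gamma [[f [g [Hf [Hg [Hf1 [Hg1 Hgf]]]]]] Hlim]].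
    assert (Hneq := tail_coef_neq0 i j gamma Hin Hlim).
    destruct (isLaurent_Q f Hf) as [mf [fc Ef]]. destruct (isLaurent_K g Hg) as [mg [gc Eg]].
    exists mf, fc, mg, gc. repeat split.
    + rewrite <- Ef, Hf1 by apply C1_nz. reflexivity.
    + rewrite <- Eg, Hg1 by apply C1_nz. intros E. apply Hneq, RtoC_inj, E.
    + intros z Hz Hz0. rewrite <- Ef, <- Eg by exact Hz0. apply (Hgf z Hz Hz0).
    + rewrite <- Eg, Hg1 in H by apply C1_nz. apply RtoC_inj in H. subst g1.
      fold casym. assert (Hc := casym_pos).
      assert (H1 : is_lim_seq (fun k => p_hit i j k * weight k / (casym * gamma)) 1).
      { replace (Finite 1) with (Finite (casym * gamma / (casym * gamma))) by (f_equal; field; lra).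
        apply is_lim_seq_div'; [exact Hlim|apply is_lim_seq_const|].
        apply Rmult_integral_contrapositive; split; lra. }
      eapply is_lim_seq_ext_loc; [|exact H1]. exists 1%nat. intros [|k] Hk; [lia|].
      assert (Hw := weight_S_pos k). fold (weight (S k)). field. repeat split; lra.
    + rewrite <- Eg, Hg1 in H by apply C1_nz. apply RtoC_inj in H. subst g1.
      exists (fun k => Series (fun l => p_hit i j (k + l))). split.
      * intros k. apply Series_correct, (ex_series_incr_n (p_hit i j) k), ex_series_p_hit.
      * assert (Hc := casym_pos). assert (Hpi := PI_RGT_0). assert (Hs2 := sqrt2_bounds).
        assert (Ec : sqrt (2 * (sqrt 2 - 1) / PI) = 2 * casym).
        { replace (2 * (sqrt 2 - 1) / PI) with (2 ^ 2 * ((sqrt 2 - 1) / (2 * PI))) by (field; lra).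
          rewrite sqrt_mult_alt by lra. rewrite (sqrt_pow2 2) by lra. reflexivity. }
        rewrite Ec.
        assert (H1 := tail_asymptotics _ _ (ex_series_p_hit i j) Hlim).
        assert (H2 : is_lim_seq (fun k => Series (fun l => p_hit i j (k + l)) * sqrt (INR k)
                        / (2 * (casym * gamma))) 1).
        { replace (Finite 1) with (Finite (2 * (casym * gamma) / (2 * (casym * gamma))))
            by (f_equal; field; lra).
          apply is_lim_seq_div'; [exact H1|apply is_lim_seq_const|].
          assert (casym * gamma <> 0) by (apply Rmult_integral_contrapositive; split; lra). lra. }
        eapply is_lim_seq_ext_loc; [|exact H2]. exists 1%nat. intros k Hk.
        assert (Hp : 0 < sqrt (INR k)) by (apply sqrt_lt_R0, lt_0_INR; lia).
        simpl. field. repeat split; lra.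
  - intros z Hz Hz0.
    refine (is_gf_ext q_coef q_coef z _ _ (fun _ => eq_refl) _ (is_gf_q_coef z Hz Hz0)). field. exact Hz0.
Qed.
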